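(* Let $\{\mathbf{x}_k\}_{k\ge1}$ be an infinite sequence of iterates generated by the algorithm ACSA. Then the total sequence $\{\mathbf{x}_k\}$ has finite length, i.e. $$\sum_{k}\|\mathbf{x}_{k+1}-\mathbf{x}_k\|<+\infty,$$ and hence the total sequence $\{\mathbf{x}_k\}$ converges to a unique critical point (a point $\mathbf{x}_*\in\mathbb{S}_{n-1}$ with $\mathbf{g}(\mathbf{x}_* )=0$).
   Context: Let $m$ be an even positive integer and $n$ a positive integer. For a real symmetric $m$th order $n$-dimensional tensor $\mathcal{A}=(a_{i_1,\ldots,i_m})$ (entries invariant under permutation of indices) and $\mathbf{x}\in\mathbb{R}^n$, let $\mathcal{A}\mathbf{x}^m=\sum_{i_1,\ldots,i_m=1}^n a_{i_1,\ldots,i_m}x_{i_1}\cdots x_{i_m}$, and let $\mathcal{A}\mathbf{x}^{m-1}\in\mathbb{R}^n$ be the vector with $i$th entry $\sum_{i_2,\ldots,i_m=1}^n a_{i,i_2,\ldots,i_m}x_{i_2}\cdots x_{i_m}$. $\mathcal{H}$ is an $m$th order $n$-dimensional Hankel tensor, i.e. $h_{i_1,\ldots,i_m}=v_{i_1+\cdots+i_m-m}$ for a real generating vector $\mathbf{v}=(v_0,\ldots,v_{m(n-1)})^{\top}$. $\mathcal{B}$ is a symmetric $m$th order $n$-dimensional tensor that is positive definite: $\mathcal{B}\mathbf{x}^m>0$ for all $\mathbf{x}\neq 0$. The norm $\|\cdot\|$ is Euclidean and $\mathbb{S}_{n-1}=\{\mathbf{x}\in\mathbb{R}^n:\mathbf{x}^{\top}\mathbf{x}=1\}$.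 Put $f(\mathbf{x})=\dfrac{\mathcal{H}\mathbf{x}^m}{\mathcal{B}\mathbf{x}^m}$ for $\mathbf{x}\ne0$, whose gradient is $\mathbf{g}(\mathbf{x})=\nabla f(\mathbf{x})=\dfrac{m}{\mathcal{B}\mathbf{x}^m}\Big(\mathcal{H}\mathbf{x}^{m-1}-\dfrac{\mathcal{H}\mathbf{x}^m}{\mathcal{B}\mathbf{x}^m}\mathcal{B}\mathbf{x}^{m-1}\Big)$. Algorithm ACSA. Parameters: $\eta\in(0,\tfrac12]$, $\beta\in(0,1)$, $\alpha_{\max}\ge1$; start from $\mathbf{x}_1\in\mathbb{S}_{n-1}$ and $\bar\alpha_1=1$. For $k=1,2,\ldots$: with $$\mathbf{x}_{k+1}(\alpha)=\frac{1-\alpha^2\|\mathbf{g}(\mathbf{x}_k)\|^2}{1+\alpha^2\|\mathbf{g}(\mathbf{x}_k)\|^2}\mathbf{x}_k-\frac{2\alpha}{1+\alpha^2\|\mathbf{g}(\mathbf{x}_k)\|^2}\mathbf{g}(\mathbf{x}_k),$$ choose the smallest nonnegative integer $\ell$ such that $\alpha_k=\beta^{\ell}\bar\alpha_k$ satisfies $f(\mathbf{x}_{k+1}(\alpha_k))\le f(\mathbf{x}_k)-\eta\alpha_k\|\mathbf{g}(\mathbf{x}_k)\|^2$; set $\mathbf{x}_{k+1}=\mathbf{x}_{k+1}(\alpha_k)$; choose the next initial step size $\bar\alpha_{k+1}\in(0,\alpha_{\max}]$ as $\bar\alpha_{k+1}=\min\{\alpha_{\max},\|\mathbf{x}_{k+1}-\mathbf{x}_k\|/\|\mathbf{g}(\mathbf{x}_{k+1})-\mathbf{g}(\mathbf{x}_k)\|\}$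 (equal to $\alpha_{\max}$ if the denominator is zero). The algorithm generates an infinite sequence when $\mathbf{g}(\mathbf{x}_k)\ne0$ for all $k$. *)

(* Defs.v *)
From HB Require Import structures.
From mathcomp Require Import all_boot all_order all_algebra.
From mathcomp Require Import perm ring.
From mathcomp Require Import all_classical all_reals all_analysis.

Set Implicit Arguments.
Unset Strict Implicit.
Unset Printing Implicit Defensive.

Import Order.TTheory GRing.Theory Num.Theory.
Import numFieldNormedType.Exports.

Local Open Scope classical_set_scope.
Local Open Scope ring_scope.

(* Vectors of R^n are row vectors; their topology is the
   library one (of the sup norm), which is the Euclidean topology. *)

Section EuclideanNorm.
Variables (R : realType) (n : nat).
Implicit Type x : 'rV[R]_n.

(* The library norm [`|x|] on ['rV[R]_n] is the sup norm, hence [enorm]. *)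
Definition enorm x : R := Num.sqrt ((x *m x^T) 0 0).

Definition unit_sphere : set 'rV[R]_n := [set x | (x *m x^T) 0 0 = 1].

Definition grad (f : 'rV[R]_n -> R) x : 'rV[R]_n :=
  \row_i 'D_(delta_mx 0 i) f x.

End EuclideanNorm.

Section Tensors.
Variable R : realType.

Definition tensor (m n : nat) := m.-tuple 'I_n -> R.

Definition symmetric_tensor m n (A : tensor m n) : Prop :=
  forall s t : m.-tuple 'I_n, perm_eq s t -> A s = A t.

(* A x^m *)
Definition tensor_form m n (A : tensor m n) (x : 'rV[R]_n) : R :=
  \sum_(t : m.-tuple 'I_n) A t * \prod_(j < m) x 0 (tnth t j).

(* A x^(m-1) for A of order m; the order m is written m.+1 here. *)
Definition tensor_vec m n (A : tensor m.+1 n) (x : 'rV[R]_n) : 'rV[R]_n :=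
  \row_i \sum_(t : m.-tuple 'I_n)
    A [tuple of i :: t] * \prod_(j < m) x 0 (tnth t j).

Definition posdef_tensor m n (A : tensor m n) : Prop :=
  forall x : 'rV[R]_n, x != 0 -> 0 < tensor_form A x.

(* With indices starting at 0, the entry v_(i_1 + ... + i_m - m) is indexed by
   the plain sum of the indices, which never exceeds m * (n - 1), so that
   [inord] does not truncate. *)
Definition hankel_tensor m n (v : 'rV[R]_(m * n.-1).+1) : tensor m n :=
  fun t => v 0 (inord (\sum_(j < m) tnth t j)%N).

(* Meaningful where [tensor_form B x != 0]; it is 0 elsewhere. *)
Definition tensor_quotient m n (A B : tensor m n) (x : 'rV[R]_n) : R :=
  tensor_form A x / tensor_form B x.

End Tensors.

Section Gradient.
Variables (R : realType) (n : nat).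

Lemma is_derive_prod (I : eqType) (r : seq I) (h : I -> 'rV[R]_n -> R)
    (dh : I -> R) (x v : 'rV[R]_n) : uniq r ->
  (forall j, is_derive x v (h j) (dh j)) ->
  is_derive x v (fun y => \prod_(j <- r) h j y)
    (\sum_(j <- r) dh j * \prod_(k <- r | k != j) h k x).
Proof.
move=> + dhP; elim: r => [_|a r IH /= /andP[ar /IH dr]].
  rewrite big_nil; under eq_fun do rewrite big_nil; exact: is_derive_cst.
under eq_fun do rewrite big_cons.
apply: (is_derive_eq (is_deriveM (dhP a) dr)).
rewrite !big_cons eqxx /= addrC; congr (_ + _).
  rewrite [LHS]mulrC; congr (_ * _); rewrite [LHS]big_seq [RHS]big_seq_cond.
  apply: eq_bigl => k; case: (boolP (k \in r)) => //= kr.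
  by apply/esym; apply: contraNneq ar => <-.
rewrite scaler_sumr [LHS]big_seq [RHS]big_seq; apply: eq_bigr => j jr.
rewrite big_cons ifT; first exact: mulrCA.
by apply: contraNneq ar => ->.
Qed.

Lemma is_derive_coord (x v : 'rV[R]_n) (i : 'I_n) :
  is_derive x v (fun y : 'rV[R]_n => y 0 i) (v 0 i).
Proof.
have dx : differentiable (fun y : 'rV[R]_n => y 0 i) x.
  exact: differentiable_coord.
apply: DeriveDef; first exact: diff_derivable.
rewrite deriveE//.
have lin : linear (fun y : 'rV[R]_n => y 0 i : R^o).
  by move=> a y z; rewrite !mxE.
pose L := GRing.isLinear.Build R 'rV[R]_n R _ (fun y : 'rV[R]_n => y 0 i) lin.
pose F : {linear 'rV[R]_n -> R} := HB.pack (fun y : 'rV[R]_n => y 0 i) L.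
rewrite (@diff_lin _ _ _ F)//; exact: coord_continuous.
Qed.

Lemma is_derive_sumT (I : finType) (h : I -> 'rV[R]_n -> R) (dh : I -> R)
    (x v : 'rV[R]_n) :
  (forall j, is_derive x v (h j) (dh j)) ->
  is_derive x v (fun y => \sum_j h j y) (\sum_j dh j).
Proof.
move=> dhP; rewrite (_ : (fun _ => _) = \sum_j h j); last first.
  by apply/funext => y; rewrite fct_sumE.
elim/big_ind2 : _ => // [|f a g b df dg].
  exact: is_derive_cst.
exact: is_deriveD.
Qed.

Lemma is_derive_tensor_form m (A : tensor R m.+1 n) (x : 'rV[R]_n) i :
  symmetric_tensor A ->
  is_derive x (delta_mx 0 i) (tensor_form A) (m.+1%:R * tensor_vec A x 0 i).
Proof.
move=> Asym; pose d := delta_mx 0 i : 'rV[R]_n.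
pose P (t : m.+1.-tuple 'I_n) j :=
  d 0 (tnth t j) * \prod_(k < m.+1 | k != j) x 0 (tnth t k).
have dA : is_derive x d (tensor_form A) (\sum_t A t * \sum_j P t j).
  apply: is_derive_sumT => t; apply: is_deriveZ.
  apply: is_derive_prod; first exact: index_enum_uniq.
  by move=> j; exact: is_derive_coord.
apply: (is_derive_eq dA).
under eq_bigr do rewrite mulr_sumr.
rewrite exchange_big /= mulr_natl.
transitivity (\sum_(j < m.+1) tensor_vec A x 0 i); last first.
  by rewrite sumr_const card_ord.
apply: eq_bigr => j _.
pose sw (t : m.+1.-tuple 'I_n) := [tuple tnth t (tperm ord0 j k) | k < m.+1].
have swK : involutive sw.
  by move=> t; apply: eq_from_tnth => k; rewrite !tnth_mktuple tpermK.
rewrite (reindex_inj (inv_inj swK)) /=.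
transitivity (\sum_t A t * P t ord0).
  apply: eq_bigr => t _; congr (_ * _).
    apply: Asym; apply/tuple_permP; exists (tperm ord0 j).
    by rewrite /sw.
  rewrite /P tnth_mktuple tpermR; congr (_ * _).
  rewrite (reindex_inj (@perm_inj _ (tperm ord0 j))) /=.
  apply: eq_big => [k|k _]; last by rewrite tnth_mktuple tpermK.
  by rewrite -{2}(tpermL ord0 j) (inj_eq perm_inj).
pose h (u : 'I_n * m.-tuple 'I_n) := [tuple of u.1 :: u.2].
pose h' (t : m.+1.-tuple 'I_n) := (thead t, [tuple of behead t]).
have hK : cancel h h' by case=> a u; congr (_, _); apply: val_inj.
have h'K : cancel h' h by move=> t; rewrite [RHS]tuple_eta; apply: val_inj.
rewrite (reindex h) /=; last by exists h' => ? _.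
rewrite -(pair_bigA _ (fun a u => A (h (a, u)) * P (h (a, u)) ord0)) /=.
rewrite (bigD1 i) //= addrC big1 ?add0r => [|a ai]; last first.
  by apply: big1 => u _; rewrite /P /d mxE tnth0 (negPf ai) andbF mul0r mulr0.
rewrite mxE; apply: eq_bigr => u _; congr (_ * _).
rewrite /P /d mxE tnth0 !eqxx mul1r big_mkcond big_ord_recl eqxx /= mul1r.
by apply: eq_bigr => k _; rewrite tnthS.
Qed.

(* [grad] is built from directional derivatives, which are total in the library;
   away from the zeros of [tensor_form B] it is the genuine gradient. *)
Lemma grad_tensor_quotient m (A B : tensor R m.+1 n) (x : 'rV[R]_n) :
  symmetric_tensor A -> symmetric_tensor B -> tensor_form B x != 0 ->
  grad (tensor_quotient A B) x =
  (m.+1%:R / tensor_form B x) *: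
    (tensor_vec A x - (tensor_form A x / tensor_form B x) *: tensor_vec B x).
Proof.
move=> As Bs B0; apply/rowP => i.
have dA := is_derive_tensor_form x i As.
have dB := is_derive_tensor_form x i Bs.
have dVB := derivableV B0 (@ex_derive _ _ _ _ _ _ _ dB).
rewrite mxE (_ : tensor_quotient A B =
  tensor_form A * (fun y => (tensor_form B y)^-1)) //.
rewrite deriveM // deriveV // !derive_val.
move: (tensor_vec A x) (tensor_vec B x) => a b.
by rewrite /GRing.scale /= !mxE; field.
Qed.

Lemma hankel_tensor_sym m (v : 'rV[R]_(m * n.-1).+1) :
  symmetric_tensor (hankel_tensor v).
Proof.
move=> s t st; congr (v 0 (inord _)).
have tnthE (u : m.-tuple 'I_n) :
  (\sum_(j < m) tnth u j = \sum_(i <- u) i)%N by rewrite [RHS]big_tuple.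
by rewrite !tnthE; exact: perm_big.
Qed.

End Gradient.

Section ACSA.
Variables (R : realType) (n : nat) (f : 'rV[R]_n -> R).
Variables (eta beta amax : R).

Local Notation g := (grad f).

Definition acsa_curve (x : 'rV[R]_n) (a : R) : 'rV[R]_n :=
  let c := a ^+ 2 * enorm (g x) ^+ 2 in
  ((1 - c) / (1 + c)) *: x - (2 * a / (1 + c)) *: g x.

Definition acsa_decrease (x : 'rV[R]_n) (a : R) : Prop :=
  f (acsa_curve x a) <= f x - eta * a * enorm (g x) ^+ 2.

Definition acsa_initial_step (x y : 'rV[R]_n) : R :=
  if g y == g x then amax
  else Num.min amax (enorm (y - x) / enorm (g y - g x)).

(* An infinite run.  Sequences are indexed from 0: [x k], [alpha k] and
   [abar k] are the k+1-st iterate, step size and initial step size. *)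
Record acsa_run (x : nat -> 'rV[R]_n) (alpha abar : nat -> R) : Prop := {
  acsa_x0 : unit_sphere (x 0%N);
  acsa_abar0 : abar 0%N = 1;
  acsa_grad_neq0 : forall k, g (x k) <> 0;
  acsa_line_search : forall k, exists l : nat,
    [/\ alpha k = beta ^+ l * abar k,
        acsa_decrease (x k) (alpha k) &
        forall j, (j < l)%N -> ~ acsa_decrease (x k) (beta ^+ j * abar k)];
  acsa_xS : forall k, x k.+1 = acsa_curve (x k) (alpha k);
  acsa_abarS : forall k, abar k.+1 = acsa_initial_step (x k) (x k.+1)
}.

End ACSA.

(* Main.v *)
Require Import Defs.
From mathcomp Require Import all_boot all_order all_algebra.
From mathcomp Require Import ring lra zify.
From mathcomp Require ordered_qelim qe_rcf.
From mathcomp Require Import all_classical all_reals all_analysis.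

(* The heart of the proof is a Kurdyka-Lojasiewicz inequality on the sphere.
   There [|grad f|] is comparable to [sqrt W], where [W] is the polynomial
   [|B(x) H x^(m-1) - H(x) B x^(m-1)|^2].  For a given value [c] and small
   [t > 0], let [gamma t] be the lexicographically least minimizer of [W] on the
   level set [f = c + t] of the sphere.  By quantifier elimination every one
   variable set built from [gamma] is a finite union of intervals, so that
   [W (gamma t)] and the coordinates of [gamma] are monotone near [0+], and the
   total variation [V] of [gamma] is bounded.  The quadratic expansion of [f] at
   [gamma t] gives [|t - s| <= 2 L sqrt (W (gamma t)) |V t - V s|] for [s] close to
   [t], even across a jump of [gamma], and hence
   [t - s <= 2 L sqrt (W x) (V t - V s)] whenever [f x = c + t] and [0 < s < t],
   if [W (gamma t)] is nondecreasing; otherwise it stays away from [0], and the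
   inequality holds with a multiple of [t] in place of [V t].
   With [c] the limit of the values of [f] along the iterates, the sufficient
   decrease of the line search, whose step sizes are bounded below, gives
   [|x_(k+1) - x_k| <= C (V t_k - V t_(k+1))], which telescopes. *)

Set Implicit Arguments.
Unset Strict Implicit.
Unset Printing Implicit Defensive.

Import Order.TTheory GRing.Theory Num.Theory.
Import numFieldNormedType.Exports.

Local Open Scope classical_set_scope.
Local Open Scope ring_scope.

(** * Sets definable over a real closed field *)

Module ord := ordered_qelim.ord.

Section Definability.
Variable R : realType.
Implicit Types (P Q : (nat -> R) -> Prop) (T U : (nat -> R) -> R).
Implicit Types (rho : nat -> R) (e : seq R) (i : nat).


(* Valuations are functions on [nat], so that they are equal as soon as they
   agree everywhere; a formula is only evaluated at finitely supported ones. *)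
Definition definable P := exists2 f : ord.formula R,
  ord.rformula f & forall e, ord.holds e f <-> P (nth 0 e).

(** [GRing.rterm] excludes inverses, so these are polynomial functions of the variables. *)
Definition polyfun T := exists2 t : GRing.term R,
  GRing.rterm t & forall e, GRing.eval e t = T (nth 0 e).

Definition upd rho i x : nat -> R := fun j => if j == i then x else rho j.

Lemma nth_set_nthE e i x : nth 0 (set_nth 0 e i x) = upd (nth 0 e) i x.
Proof. by apply/funext => j; rewrite nth_set_nth. Qed.

Lemma polyfun_var i : polyfun (fun rho => rho i).
Proof. by exists (GRing.Var _ i). Qed.

Lemma polyfun_const c : polyfun (fun _ => c).
Proof. by exists (GRing.Const c). Qed.

Lemma polyfunD T U : polyfun T -> polyfun U -> polyfun (fun rho => T rho + U rho).
Proof.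
move=> [t tr tE] [u ur uE]; exists (GRing.Add t u); first by rewrite /= tr.
by move=> e; rewrite /= tE uE.
Qed.

Lemma polyfunM T U : polyfun T -> polyfun U -> polyfun (fun rho => T rho * U rho).
Proof.
move=> [t tr tE] [u ur uE]; exists (GRing.Mul t u); first by rewrite /= tr.
by move=> e; rewrite /= tE uE.
Qed.

Lemma polyfunB T U : polyfun T -> polyfun U -> polyfun (fun rho => T rho - U rho).
Proof.
move=> [t tr tE] [u ur uE]; exists (GRing.Add t (GRing.Opp u)).
  by rewrite /= tr.
by move=> e; rewrite /= tE uE.
Qed.

Lemma definable_ext P Q : (forall rho, P rho <-> Q rho) ->
  definable P -> definable Q.
Proof. by move=> PQ [f fr fP]; exists f => // e; rewrite fP PQ. Qed.

Lemma definable_lt T U : polyfun T -> polyfun U ->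
  definable (fun rho => T rho < U rho).
Proof.
move=> [t tr tE] [u ur uE]; exists (ord.Lt t u); first by rewrite /= tr.
by move=> e; rewrite /= tE uE.
Qed.

Lemma definable_le T U : polyfun T -> polyfun U ->
  definable (fun rho => T rho <= U rho).
Proof.
move=> [t tr tE] [u ur uE]; exists (ord.Le t u); first by rewrite /= tr.
by move=> e; rewrite /= tE uE.
Qed.

Lemma definable_eq T U : polyfun T -> polyfun U ->
  definable (fun rho => T rho = U rho).
Proof.
move=> [t tr tE] [u ur uE]; exists (ord.Equal t u); first by rewrite /= tr.
by move=> e; rewrite /= tE uE.
Qed.

Lemma definable_and P Q : definable P -> definable Q ->
  definable (fun rho => P rho /\ Q rho).
Proof.
move=> [f fr fE] [g gr gE]; exists (ord.And f g); first by rewrite /= fr.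
by move=> e; rewrite /= fE gE.
Qed.

Lemma definable_not P : definable P -> definable (fun rho => ~ P rho).
Proof. by move=> [f fr fE]; exists (ord.Not f) => // e; rewrite /= fE. Qed.

Lemma definable_imp P Q : definable P -> definable Q ->
  definable (fun rho => P rho -> Q rho).
Proof.
move=> [f fr fE] [g gr gE]; exists (ord.Implies f g); first by rewrite /= fr.
by move=> e; rewrite /= fE gE.
Qed.

Lemma definable_ex i P : definable P ->
  definable (fun rho => exists x, P (upd rho i x)).
Proof.
move=> [f fr fE]; exists (ord.Exists i f) => // e /=.
by split=> -[x]; rewrite ?fE -?nth_set_nthE -?fE; exists x;
  rewrite ?fE ?nth_set_nthE// -nth_set_nthE -fE.
Qed.

Lemma definable_all i P : definable P ->
  definable (fun rho => forall x, P (upd rho i x)).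
Proof.
move=> [f fr fE]; exists (ord.Forall i f) => // e /=.
by split=> h x; move: (h x); rewrite fE nth_set_nthE.
Qed.

(** * Quantification over vectors stored in consecutive variables *)

Section Blocks.
Variable n : nat.

Definition mix rho k m (s : nat -> R) : nat -> R :=
  fun j => if (k <= j < k + m)%N then s j else rho j.

Definition block k rho : 'rV[R]_n := \row_i rho (k + i)%N.

Definition updv rho k (v : 'rV[R]_n) : nat -> R :=
  mix rho k n (fun j => oapp (v 0) 0 (insub (j - k)%N : option 'I_n)).

(** Induction on [m]: the last variable of the block, [k + m], is quantified innermost as a
    scalar. *)
Lemma definable_mix k m P : definable P ->
  definable (fun rho => exists s, P (mix rho k m s)).
Proof.
elim: m P => [|m IH] P dP.
  apply: definable_ext dP => rho.
  have mixE s : mix rho k 0 s = rho.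
    by apply/funext => j; rewrite /mix addn0; case: ifPn => // /andP[]; lia.
  by split=> [|[s]]; [exists rho|]; rewrite mixE.
apply: definable_ext (IH _ (definable_ex (k + m) dP)) => rho; split.
  move=> [s [x Px]]; exists (upd s (k + m) x); congr P: Px.
  apply/funext => j; rewrite /mix /upd; case: eqP => [->|jkm].
    by rewrite ifT //; lia.
  by do 2?[case: ifP] => //; lia.
move=> [s Ps]; exists s, (s (k + m)%N); congr P: Ps.
apply/funext => j; rewrite /mix /upd; case: eqP => [->|jkm].
  by rewrite ifT //; lia.
by do 2?[case: ifP] => //; lia.
Qed.

Lemma definable_exv k P : definable P ->
  definable (fun rho => exists v, P (updv rho k v)).
Proof.
move=> dP; apply: definable_ext (definable_mix k n dP) => rho; split.
  move=> [s Ps]; exists (block k s); congr P: Ps.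
  apply/funext => j; rewrite /updv /mix; case: ifP => // /andP[kj jn].
  have jkn : (j - k < n)%N by lia.
  by rewrite insubT /= mxE /= subnKC.
by move=> [v Pv]; eexists; exact: Pv.
Qed.

Lemma definable_allv k P : definable P ->
  definable (fun rho => forall v, P (updv rho k v)).
Proof.
move=> /definable_not/(definable_exv k)/definable_not.
apply: definable_ext => rho; split=> [h v|h [v]]; last by apply.
by apply: contrapT => Pv; apply: h; exists v.
Qed.

Lemma block_updv rho k v : block k (updv rho k v) = v.
Proof.
apply/rowP => i; rewrite mxE /updv /mix ifT; last first.
  by rewrite leq_addr ltn_add2l ltn_ord.
by rewrite addKn valK.
Qed.

Lemma block_updv_out rho k l v : (l + n <= k)%N ->
  block l (updv rho k v) = block l rho.
Proof.
move=> lk; apply/rowP => i; rewrite !mxE /updv /mix ifF //.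
by have := ltn_ord i; lia.
Qed.

Lemma updv_out rho k j v : (j < k)%N -> updv rho k v j = rho j.
Proof. by move=> jk; rewrite /updv /mix ifF //; lia. Qed.

Lemma polyfun_block k (i : 'I_n) : polyfun (fun rho => block k rho 0 i).
Proof. by under eq_fun do rewrite mxE; exact: polyfun_var. Qed.

End Blocks.

(** The form in which o-minimality is used: a definable set of reals contains or misses a one-sided
    neighbourhood of any given point. *)
Definition decided (F : set_system R) (A : R -> Prop) :=
  (\forall x \near F, A x) \/ (\forall x \near F, ~ A x).

(** * One-sided behaviour of definable sets of reals *)

Section Tameness.
Variables (t s : R) (F : set_system R).
Context {FF : Filter F}.
Hypothesis Ft : F --> t.
Hypothesis Fs : \forall x \near F, Num.sg (x - t) = s.

(** Write [p] as [q] times a power of ['X - t%:P] with [q.[t] != 0]: the sign of [q] is locally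
    constant by continuity, and that of [x - t] is [s] along [F]. With [s] as a parameter both sides
    of [t] are treated at once. *)
Lemma poly_sg_near (p : {poly R}) : exists c, \forall x \near F, Num.sg p.[x] = c.
Proof.
have [->|p0] := eqVneq p 0.
  by exists 0; near=> x; rewrite horner0 sgr0.
have [m [q]] := multiplicity_XsubC p t; rewrite p0 /= => qt ->.
exists (Num.sg q.[t] * s ^+ m).
have sgq : \forall x \near F, Num.sg q.[x] = Num.sg q.[t].
  have qc : q.[x] @[x --> F] --> q.[t].
    by apply: cvg_comp Ft _; exact: continuous_horner.
  have [q0|q0|q0] := ltgtP q.[t] 0; last by rewrite /root q0 eqxx in qt.
    near=> x; rewrite !ltr0_sg //; near: x; exact: (cvgr_lt _ qc).
  near=> x; rewrite !gtr0_sg //; near: x; exact: (cvgr_gt _ qc).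
near=> x; rewrite hornerM horner_exp hornerXsubC sgrM sgrX.
by congr (_ * _ ^+ _); near: x.
Unshelve. all: by end_near. Qed.

Lemma decided_and A B : decided F A -> decided F B ->
  decided F (fun x => A x /\ B x).
Proof.
by move=> [a|a] [b|b]; [left|right|right|right]; apply: filterS2 a b => x; tauto.
Qed.

Lemma decided_not A : decided F A -> decided F (fun x => ~ A x).
Proof. by move=> [a|a]; [right|left]; apply: filterS a => x; tauto. Qed.

Lemma decided_ext A B : (forall x, A x <-> B x) -> decided F A -> decided F B.
Proof. by move=> AB; rewrite (_ : A = B)//; apply/funext => x; apply/propext. Qed.

Lemma decided_sg A (p : {poly R}) (b : R -> Prop) :
  (forall x, A x <-> b (Num.sg p.[x])) -> decided F A.
Proof.
move=> AE; have [c pc] := poly_sg_near p.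
have [bc|bc] := pselect (b c); [left|right]; near=> x; rewrite AE.
all: by rewrite (near pc x).
Unshelve. all: by end_near. Qed.

Lemma term_poly e i (u : GRing.term R) : GRing.rterm u ->
  exists p : {poly R}, forall x, GRing.eval (set_nth 0 e i x) u = p.[x].
Proof.
elim: u => //=.
- move=> j _; have [->|ji] := eqVneq j i.
    by exists 'X => x; rewrite nth_set_nth /= eqxx hornerX.
  by exists (e`_j)%:P => x; rewrite nth_set_nth /= (negPf ji) hornerC.
- by move=> c _; exists c%:P => x; rewrite hornerC.
- by move=> m _; exists m%:R%:P => x; rewrite hornerC.
- move=> u IHu v IHv /andP[/IHu[p pE] /IHv[q qE]].
  by exists (p + q) => x; rewrite hornerD pE qE.
- by move=> u IHu /IHu[p pE]; exists (- p) => x; rewrite hornerN pE.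
- by move=> u IHu m /IHu[p pE]; exists (p *+ m) => x; rewrite hornerMn pE.
- move=> u IHu v IHv /andP[/IHu[p pE] /IHv[q qE]].
  by exists (p * q) => x; rewrite hornerM pE qE.
- by move=> u IHu m /IHu[p pE]; exists (p ^+ m) => x; rewrite horner_exp pE.
Qed.

(** Once the other variables are fixed, an atom is a condition on the sign of one univariate
    polynomial. Disjunction and implication are reduced to conjunction and negation. *)
Lemma decided_qf e i (f : ord.formula R) : ord.rformula f -> ord.qf_form f ->
  decided F (fun x => ord.qf_eval (set_nth 0 e i x) f).
Proof.
elim: f => //=.
- by move=> b _ _; case: b; [left|right]; near=> x.
- move=> u v /andP[/(term_poly e i)[p pE] /(term_poly e i)[q qE]] _.
  apply: (@decided_sg _ (p - q) (fun c => c = 0)) => x; rewrite pE qE.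
  rewrite hornerD hornerN; split=> [/eqP->|/eqP]; first by rewrite subrr sgr0.
  by rewrite sgr_eq0 subr_eq0.
- move=> u v /andP[/(term_poly e i)[p pE] /(term_poly e i)[q qE]] _.
  apply: (@decided_sg _ (q - p) (fun c => c = 1)) => x; rewrite pE qE.
  rewrite hornerD hornerN; split=> [pq|/eqP].
    by rewrite gtr0_sg ?subr_gt0.
  by rewrite sgr_cp0 subr_gt0.
- move=> u v /andP[/(term_poly e i)[p pE] /(term_poly e i)[q qE]] _.
  apply: (@decided_sg _ (q - p) (fun c => 0 <= c)) => x; rewrite pE qE.
  by rewrite hornerD hornerN sgr_ge0 subr_ge0.
- move=> f IHf g IHg /andP[fr gr] /andP[fq gq].
  apply: decided_ext (decided_and (IHf fr fq) (IHg gr gq)) => x.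
  by split=> /andP.
- move=> f IHf g IHg /andP[fr gr] /andP[fq gq].
  have := decided_and (decided_not (IHf fr fq)) (decided_not (IHg gr gq)).
  move/decided_not; apply: decided_ext => x.
  by case: (ord.qf_eval _ f); case: (ord.qf_eval _ g) => /=; intuition.
- move=> f IHf g IHg /andP[fr gr] /andP[fq gq].
  have := decided_and (IHf fr fq) (decided_not (IHg gr gq)).
  move/decided_not; apply: decided_ext => x.
  by case: (ord.qf_eval _ f); case: (ord.qf_eval _ g) => /=; intuition.
- move=> f IHf fr fq; apply: decided_ext (decided_not (IHf fr fq)) => x.
  by split=> /negP.
Unshelve. all: by end_near. Qed.

(** Quantifier elimination over real closed fields reduces this to the quantifier-free case. *)
Lemma decided_definable P e i : definable P ->
  decided F (fun x => P (upd (nth 0 e) i x)).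
Proof.
move=> [f fr fP].
have wf := @qe_rcf.wf_QE_wproj R.
have qP e' := ord.quantifier_elim_rformP wf (@qe_rcf.valid_QE_wproj R) e' fr.
have /andP[gq gr] := ord.quantifier_elim_wf wf fr.
apply: decided_ext (decided_qf e i gr gq) => x; rewrite -nth_set_nthE -fP.
by split=> /qP.
Qed.

End Tameness.

Lemma tame_right P e i t : definable P ->
  decided t^'+ (fun x => P (upd (nth 0 e) i x)).
Proof.
apply: (@decided_definable t 1); first exact: cvg_at_right_filter.
by near=> x; rewrite gtr0_sg // subr_gt0.
Unshelve. all: by end_near. Qed.

Lemma tame_left P e i t : definable P ->
  decided t^'- (fun x => P (upd (nth 0 e) i x)).
Proof.
apply: (@decided_definable t (-1)); first exact: cvg_at_left_filter.
by near=> x; rewrite ltr0_sg // subr_lt0.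
Unshelve. all: by end_near. Qed.

End Definability.

(** * Monotonicity of definable functions of one variable *)

Section Monotonicity.
Variable R : realType.
Implicit Types (r s t : R).

(** The explicit radius makes a one-sided neighbourhood a first-order condition, so that it can
    occur in a definable predicate. *)
Lemma near_rightP (A : R -> Prop) t : (\forall s \near t^'+, A s) <->
  exists r, 0 < r /\ forall s, t < s < t + r -> A s.
Proof.
split=> [|[r [r0 rA]]]; last first.
  near=> s; apply: rA; apply/andP; split => //.
  by near: s; apply: nbhs_right_lt; rewrite ltrDl.
rewrite /at_right near_withinE => /nbhs_ballP[r /= r0 rA]; exists r; split => // s.
move=> /andP[ts str]; apply: rA => //; rewrite /ball /= ltr_distlC; lra.
Unshelve. all: by end_near. Qed.

Lemma near_leftP (A : R -> Prop) t : (\forall s \near t^'-, A s) <->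
  exists r, 0 < r /\ forall s, t - r < s < t -> A s.
Proof.
split=> [|[r [r0 rA]]]; last first.
  near=> s; apply: rA; apply/andP; split => //.
  by near: s; apply: nbhs_left_gt; rewrite ltrBlDr ltrDl.
rewrite /at_left near_withinE => /nbhs_ballP[r /= r0 rA]; exists r; split => // s.
move=> /andP[ts str]; apply: rA => //; rewrite /ball /= ltr_distlC; lra.
Unshelve. all: by end_near. Qed.

(** Real induction on the set [E] of the points up to which [Q a] holds: its supremum belongs to it
    by the hypothesis on the left, and would be exceeded by the one on the right if it were smaller
    than [b]. *)
Lemma local_to_global (Q : R -> R -> Prop) a b :
  (forall r s t, Q r s -> Q s t -> Q r t) ->
  (forall t, a <= t < b -> \forall s \near t^'+, Q t s) ->
  (forall t, a < t <= b -> \forall s \near t^'-, Q s t) ->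
  a < b -> Q a b.
Proof.
move=> Qtr Qr Ql ab.
pose E : set R := [set c | a < c <= b /\ forall u, a < u <= c -> Q a u].
have Eext c : a <= c < b -> (forall u, a < u <= c -> Q a u) ->
    exists2 d, c < d & E d.
  move=> acb Qc; have /andP[ac cb] := acb.
  have [r [r0 rQ]] := (near_rightP _ _).1 (Qr _ acb).
  exists (Num.min b (c + r / 2)); first by rewrite lt_min cb ltrDl divr_gt0.
  have h1 : c < Num.min b (c + r / 2) by rewrite lt_min cb ltrDl divr_gt0.
  have h2 : Num.min b (c + r / 2) <= b by rewrite ge_min lexx.
  have h3 : Num.min b (c + r / 2) <= c + r / 2 by rewrite ge_min lexx orbT.
  split; first lra.
  move=> u /andP[au um]; have [uc|cu] := leP u c; first by apply: Qc; lra.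
  have cuQ : Q c u by apply: rQ; lra.
  have [ac'|ac'] := ltP a c; first by apply: Qtr cuQ; apply: Qc; lra.
  by have -> : a = c by lra.
have [d ad Ed] : exists2 d, a < d & E d.
  by apply: Eext => [|u]; lra.
have supE : has_sup E by split; [exists d|exists b => c [/andP[]]].
have cb : sup E <= b by apply: ge_sup; [exists d|move=> c [/andP[]]].
have dc : d <= sup E by apply: ub_le_sup => //; case: supE.
have Qlt u : a < u < sup E -> Q a u.
  move=> /andP[au uc]; have uc' : 0 < sup E - u by lra.
  have [v [_ Ev] vu] := sup_adherent uc' supE.
  by apply: Ev; lra.
have c0 : a < sup E <= b by lra.
have Qc : Q a (sup E).
  have [r [r0 rQ]] := (near_leftP _ _).1 (Ql _ c0).
  have h1 : a < Num.max ((a + sup E) / 2) (sup E - r / 2) by rewrite lt_max; lra.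
  have h2 : Num.max ((a + sup E) / 2) (sup E - r / 2) < sup E by rewrite gt_max; lra.
  have h3 : sup E - r / 2 <= Num.max ((a + sup E) / 2) (sup E - r / 2).
    by rewrite le_max lexx orbT.
  apply: (Qtr _ (Num.max ((a + sup E) / 2) (sup E - r / 2))).
    by apply: Qlt; lra.
  by apply: rQ; lra.
have QE u : a < u <= sup E -> Q a u.
  by move=> /andP[au]; rewrite le_eqVlt => /orP[/eqP->//|uc]; apply: Qlt; lra.
have [cb'|cb'] := ltP (sup E) b; last by apply: QE; lra.
have [e ce Ee] : exists2 e, sup E < e & E e by apply: Eext => //; lra.
have := ub_le_sup supE.2 Ee; lra.
Qed.

(* A family of disjoint intervals is countable, whereas an interval is not. *)
Lemma close_pair (r : R -> R) eps : 0 < eps ->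
  (forall t, 0 < t < eps -> 0 < r t) ->
  exists s t, [/\ 0 < s, s < t, t < eps, t - s < r s & t - s < r t].
Proof.
move=> eps0 r0; apply: contrapT => noP.
pose N t := (Num.truncn (r t)^-1).+1.
(* Since [1 / N t < r t], two points with the same code share [N] and lie in one cell of length
   [1 / N]; they would form the excluded pair. Hence [code] is injective. *)
pose code t := (N t, Num.truncn (t * (N t)%:R)).
have rN t : 0 < t < eps -> (N t)%:R^-1 < r t.
  move=> /r0 rt0; rewrite invf_plt ?posrE ?ltr0n //.
  by rewrite truncnS_gt.
have code_inj : {in `]0, eps[ &, injective code}.
  suff code_lt s t : 0 < s -> s < t -> t < eps -> code s <> code t.
    move=> s t; rewrite !in_itv /= => /andP[s0 seps] /andP[t0 teps] st.
    by have [/code_lt|/code_lt|//] := ltgtP s t; [move=> h; case: h|move=> h; case: h].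
  move=> s0 st teps /pair_equal_spec[Nst].
  have N0 : 0 < (N t)%:R :> R by rewrite ltr0n.
  move=> E; apply: noP; exists s, t.
  have st0 : 0 < s < eps by lra.
  have tt0 : 0 < t < eps by lra.
  have ts : t - s < (N t)%:R^-1.
    rewrite -[X in _ < X]mul1r ltr_pdivlMr // mulrBl ltrBlDr.
    have sN : 0 <= s * (N t)%:R by rewrite mulr_ge0 ?ltW.
    have := truncn_itv sN; have tN : 0 <= t * (N t)%:R by rewrite mulr_ge0 ?ltW //; lra.
    have := truncn_itv tN; rewrite -E Nst.
    move=> /andP[_ t1] /andP[s1 _]; rewrite -natr1 in t1; lra.
  split => //; apply: lt_trans (rN _ _) => //.
  by rewrite Nst.
have cA : countable (`]0, eps[ : set R).
  have : ((`]0, eps[ : set R) #<= [set: nat * nat])%card.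
    apply/pcard_injP; exists code => //.
    by move=> x y /set_mem xI /set_mem yI; apply: code_inj.
  by move=> /card_le_trans; apply; exact: countableP.
have := countable_lebesgue_measure0 cA.
rewrite lebesgue_measure_itv /= lte_fin eps0 -EFinB subr0 => /eqP.
by rewrite eqe gt_eqF.
Qed.

(** On each side of [t], the comparison of [h] with [h t] is decided. Which alternative occurs is
    again a definable condition on [t], hence decided near [0+]. If the two sides agree,
    [local_to_global] gives monotonicity; otherwise every point is a local extremum, strict on one
    side, which [close_pair] refutes. *)
Lemma eventually_monotone (h : R -> R) (D : R -> R -> Prop) eps : 0 < eps ->
  (forall i j, definable (fun rho : nat -> R => D (rho i) (rho j))) ->
  (forall s t, 0 < s < eps -> 0 < t < eps -> (D s t <-> h s < h t)) ->
  exists d, [/\ 0 < d, d <= eps &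
    (forall s t, 0 < s -> s < t -> t < d -> h s <= h t) \/
    (forall s t, 0 < s -> s < t -> t < d -> h t <= h s)].
Proof.
move=> eps0 Ddef DP.
pose rt t := \forall s \near t^'+, D s t.
pose lt t := \forall s \near t^'-, D t s.
have rt_dec t : decided t^'+ (fun s => D s t).
  exact: (tame_right [:: 0; t] 0 t (Ddef 0 1)).
have lt_dec t : decided t^'- (fun s => D t s).
  exact: (tame_left [:: t] 1 t (Ddef 0 1)).
have rt_def : definable (fun rho : nat -> R => rt (rho 0%N)).
  apply: (@definable_ext _ (fun rho => exists r, 0 < r /\ forall s,
      rho 0%N < s /\ s < rho 0%N + r -> D s (rho 0%N))).
    move=> rho; rewrite /rt near_rightP.
    by split=> -[r [r0 rD]]; exists r; split => // s;
      [move=> /andP[]|move=> []] => a b; apply: rD; rewrite ?a.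
  apply: (definable_ex 1 (P := fun rho => 0 < rho 1%N /\ forall s,
    rho 0%N < s /\ s < rho 0%N + rho 1%N -> D s (rho 0%N))).
  apply: definable_and; first by apply: definable_lt; [exact: polyfun_const|exact: polyfun_var].
  apply: (definable_all 2 (P := fun rho => 
    rho 0%N < rho 2 /\ rho 2 < rho 0%N + rho 1%N -> D (rho 2) (rho 0%N))).
  apply: definable_imp => //; apply: definable_and; apply: definable_lt;
    do ?[exact: polyfun_var|apply: polyfunD].
have lt_def : definable (fun rho : nat -> R => lt (rho 0%N)).
  apply: (@definable_ext _ (fun rho => exists r, 0 < r /\ forall s,
      rho 0%N - r < s /\ s < rho 0%N -> D (rho 0%N) s)).
    move=> rho; rewrite /lt near_leftP.
    by split=> -[r [r0 rD]]; exists r; split => // s;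
      [move=> /andP[]|move=> []] => a b; apply: rD; rewrite ?a.
  apply: (definable_ex 1 (P := fun rho => 0 < rho 1%N /\ forall s,
    rho 0%N - rho 1%N < s /\ s < rho 0%N -> D (rho 0%N) s)).
  apply: definable_and; first by apply: definable_lt; [exact: polyfun_const|exact: polyfun_var].
  apply: (definable_all 2 (P := fun rho => 
    rho 0%N - rho 1%N < rho 2 /\ rho 2 < rho 0%N -> D (rho 0%N) (rho 2))).
  apply: definable_imp => //; apply: definable_and; apply: definable_lt;
    do ?[exact: polyfun_var|apply: polyfunB].
have near_eps t : 0 < t < eps -> (\forall s \near t^'+, 0 < s < eps) /\
                                 (\forall s \near t^'-, 0 < s < eps).
  move=> t0; split; near=> s; apply/andP; split.
  - by apply: (@lt_trans _ _ t) => //; lra.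
  - by near: s; apply: nbhs_right_lt; lra.
  - by near: s; apply: nbhs_left_gt; lra.
  - by apply: (@lt_trans _ _ t) => //; lra.
have rtN t : 0 < t < eps -> ~ rt t -> \forall s \near t^'+, h t <= h s.
  move=> t0; case: (rt_dec t) => // hD _; near=> s; rewrite leNgt.
  apply/negP => /DP; move/(_ _ t0); have : ~ D s t by near: s.
  by apply: contra_not; apply; near: s; apply: (near_eps _ t0).1.
have ltN t : 0 < t < eps -> ~ lt t -> \forall s \near t^'-, h s <= h t.
  move=> t0; case: (lt_dec t) => // hD _; near=> s; rewrite leNgt.
  apply/negP => /DP; move/(_ t0); have : ~ D t s by near: s.
  by apply: contra_not; apply; near: s; apply: (near_eps _ t0).2.
have rtP t : 0 < t < eps -> rt t -> \forall s \near t^'+, h s < h t.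
  move=> t0 rtt; near=> s; apply/DP => //; last by near: s.
  by near: s; apply: (near_eps _ t0).1.
have ltP t : 0 < t < eps -> lt t -> \forall s \near t^'-, h t < h s.
  move=> t0 ltt; near=> s; apply/DP => //; last by near: s.
  by near: s; apply: (near_eps _ t0).2.
have evt (A : R -> Prop) : (\forall t \near 0^'+, A t) ->
    exists d, [/\ 0 < d, d <= eps & forall t, 0 < t < d -> A t].
  move=> /near_rightP[r [r0 rA]]; exists (Num.min r eps).
  rewrite lt_min r0 eps0 ge_min lexx orbT; split => // t.
  by rewrite lt_min => /and3P[t0 tr _]; apply: rA; rewrite add0r t0.
(* Let [r t] be a radius on which both one-sided properties hold at [t]. The pair from [close_pair]
   has each point within the radius of the other, so both properties apply to it. *)
have local_extremum (A : R -> R -> Prop) (B : R -> R -> Prop) d : 0 < d ->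
    (forall t, 0 < t < d -> \forall s \near t^'+, A t s) ->
    (forall t, 0 < t < d -> \forall s \near t^'-, B s t) ->
    exists s t, [/\ 0 < s < d, 0 < t < d, A s t & B s t].
  move=> d0 Ad Bd.
  have /choice[r rP] : forall t, exists r, 0 < t < d -> 0 < r /\
      (forall s, t < s < t + r -> A t s) /\ (forall s, t - r < s < t -> B s t).
    move=> t; have [td|] := pselect (0 < t < d); last by exists 0.
    have [r1 [r10 r1A]] := (near_rightP _ _).1 (Ad _ td).
    have [r2 [r20 r2B]] := (near_leftP _ _).1 (Bd _ td).
    exists (Num.min r1 r2) => _; rewrite lt_min r10 r20; split => //; split => s.
      move=> /andP[ts st]; apply: r1A; rewrite ts (lt_le_trans st) //.
      by rewrite lerD2l ge_min lexx.
    move=> /andP[ts st]; apply: r2B; rewrite st andbT (le_lt_trans _ ts) //.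
    by rewrite lerD2l lerN2 ge_min lexx orbT.
  have [s [t [s0 st td sr tr]]] := close_pair d0 (fun t td => (rP t td).1).
  have sd : 0 < s < d by lra.
  have td' : 0 < t < d by lra.
  exists s, t; split => //; first by apply: (rP s sd).2.1; lra.
  by apply: (rP t td').2.2; lra.
have [/evt[d1 [d10 d1e d1P]]|/evt[d1 [d10 d1e d1P]]] := tame_right [::] 0 0 rt_def;
have [/evt[d2 [d20 d2e d2P]]|/evt[d2 [d20 d2e d2P]]] := tame_right [::] 0 0 lt_def.
all: have d0 : 0 < Num.min d1 d2 by rewrite lt_min d10.
all: have [dd1 dd2] : Num.min d1 d2 <= d1 /\ Num.min d1 d2 <= d2 by
  rewrite !ge_min !lexx orbT.
all: rewrite /upd /= in d1P d2P.
- exists (Num.min d1 d2); split; [by []|lra|right].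
  move=> a b a0 ab bd; apply: (@local_to_global (fun s t => h t <= h s)) => //.
  + by move=> r s t rs st; exact: le_trans st rs.
  + move=> t t0; apply: filterS (rtP t _ _); [by move=> s /ltW|lra|].
    by apply: d1P; lra.
  + move=> t t0; apply: filterS (ltP t _ _); [by move=> s /ltW|lra|].
    by apply: d2P; lra.
(* Every point would be a local maximum, strict on the right. *)
- exfalso.
  have [||s [t [_ _ st]]] := local_extremum (fun t s => h s < h t)
    (fun s t => h s <= h t) _ d0.
  + by move=> t t0; apply: rtP; [lra|apply: d1P; lra].
  + by move=> t t0; apply: ltN; [lra|apply: d2P; lra].
  + lra.
(* Every point would be a local minimum, strict on the left. *)
- exfalso.
  have [||s [t [_ _ st]]] := local_extremum (fun t s => h t <= h s)
    (fun s t => h t < h s) _ d0.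
  + by move=> t t0; apply: rtN; [lra|apply: d1P; lra].
  + by move=> t t0; apply: ltP; [lra|apply: d2P; lra].
  + lra.
- exists (Num.min d1 d2); split; [by []|lra|left].
  move=> a b a0 ab bd; apply: (@local_to_global (fun s t => h s <= h t)) => //.
  + by move=> r s t rs st; exact: le_trans rs st.
  + by move=> t t0; apply: rtN; [lra|apply: d1P; lra].
  + by move=> t t0; apply: ltN; [lra|apply: d2P; lra].
Unshelve. all: by end_near. Qed.

End Monotonicity.

(** * Desingularization on a compact definable set *)

Section SupNorm.
Variables (R : realType) (n : nat).

Lemma coord_le_norm (x : 'rV[R]_n) i : `|x 0 i| <= `|x|.
Proof.
rewrite [leRHS]/Num.norm /= mx_normrE.
exact: (le_bigmax _ (fun ij : 'I_1 * 'I_n => `|x ij.1 ij.2|) (0, i)).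
Qed.

Lemma norm_le_coord (x : 'rV[R]_n) c : 0 <= c -> (forall i, `|x 0 i| <= c) ->
  `|x| <= c.
Proof.
move=> c0 xc; rewrite [leLHS]/Num.norm /= mx_normrE; apply: bigmax_le => // -[i j] _.
by rewrite (ord1 i).
Qed.

End SupNorm.

Section KurdykaLojasiewicz.
Variables (R : realType) (n : nat).
Variables (S : set 'rV[R]_n) (F W : 'rV[R]_n -> R) (L : R).
Hypothesis S_cpt : compact S.
Hypothesis level_def : forall i k,
  definable (fun rho : nat -> R => S (block n k rho) /\ F (block n k rho) = rho i).
Hypothesis level_cpt : forall t, compact [set x | S x /\ F x = t].
Hypothesis W_poly : forall k, polyfun (fun rho : nat -> R => W (block n k rho)).
Hypothesis W_cont : continuous W.
Hypothesis W_ge0 : forall x, 0 <= W x.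
Hypothesis L_gt0 : 0 < L.
Hypothesis F_slope : forall x y, S x -> S y ->
  `|F y - F x| <= L * (Num.sqrt (W x) * `|y - x| + `|y - x| ^+ 2).

Definition argmin (A : set 'rV[R]_n) (u : 'rV[R]_n -> R) : set 'rV[R]_n :=
  [set x | A x /\ forall y, A y -> u x <= u y].

(** Indexed by [nat], with value [0] beyond the last coordinate, so that [stage] and [lexmin]
    recurse on plain numbers. *)
Definition coordinate j (x : 'rV[R]_n) : R := oapp (x 0) 0 (insub j : option 'I_n).

Definition stage j : 'rV[R]_n -> R := if j is i.+1 then coordinate i else W.

(* The points of the level set of [t] minimizing [W], then the first coordinate,
   then the second one, etc. *)
Fixpoint lexmin (j : nat) (t : R) : set 'rV[R]_n :=
  if j is i.+1 then argmin (lexmin i t) (stage i) else [set x | S x /\ F x = t].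

Lemma polyfun_stage j k : polyfun (fun rho : nat -> R => stage j (block n k rho)).
Proof.
case: j => [|j] /=; first exact: W_poly.
by rewrite /coordinate; case: insub => [i|] /=;
  [exact: polyfun_block|exact: polyfun_const].
Qed.

Lemma continuous_stage j : continuous (stage j).
Proof.
case: j => [|j] //=; rewrite /coordinate; case: insub => [i|] /=.
  exact: coord_continuous.
exact: cst_continuous.
Qed.

Lemma argmin_neq0 (A : set 'rV[R]_n) u : compact A -> continuous u ->
  A !=set0 -> argmin A u !=set0.
Proof.
move=> cA cu A0.
have [|c /set_mem Ac cmin] := EVT_min_rV (f := u) A0 cA.
  exact: continuous_subspaceT.
by exists c; split => // y Ay; apply: cmin; rewrite inE.
Qed.

Lemma compact_argmin (A : set 'rV[R]_n) u : compact A -> continuous u ->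
  compact (argmin A u).
Proof.
move=> cA cu; have [[c [Ac cmin]]|no] := pselect (argmin A u !=set0); last first.
  rewrite (_ : argmin A u = set0); first exact: compact0.
  by apply/seteqP; split => // x Ax; apply: no; exists x.
rewrite (_ : argmin A u = A `&` [set x | u x <= u c]).
  apply: compact_closedI => //.
  by apply: (closed_comp _ (closed_le (y := u c))) => x _; exact: cu.
apply/seteqP; split => x [Ax ux]; split => //; first exact: ux.
by move=> y Ay; apply: le_trans ux _; exact: cmin.
Qed.

Lemma compact_lexmin j t : compact (lexmin j t).
Proof.
elim: j => [|j IH]; first exact: level_cpt.
by rewrite /=; apply: compact_argmin IH _; exact: continuous_stage.
Qed.

Lemma lexmin_neq0 j t : lexmin 0 t !=set0 -> lexmin j t !=set0.
Proof.
move=> N0; elim: j => // j IH; rewrite /=; apply: argmin_neq0 => //.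
  exact: compact_lexmin.
exact: continuous_stage.
Qed.

Lemma lexmin_sub i j t : (i <= j)%N -> lexmin j t `<=` lexmin i t.
Proof.
elim: j => [|j IH]; first by rewrite leqn0 => /eqP->.
rewrite leq_eqVlt => /orP[/eqP->//|/IH sub] x.
by move=> -[/sub].
Qed.

Lemma lexmin_unique t x y : lexmin n.+1 t x -> lexmin n.+1 t y -> x = y.
Proof.
suff le a b : lexmin n.+1 t a -> lexmin n.+1 t b -> forall i, a 0 i <= b 0 i.
  by move=> xt yt; apply/rowP => i; apply/eqP; rewrite eq_le !le.
(* [W] is minimized at stage [0], so coordinate [i] is the one minimized at stage [i.+1]. *)
move=> ta tb i; have : lexmin i.+2 t a by apply: lexmin_sub ta; rewrite ltnS.
case=> _ /(_ b); rewrite /= /coordinate valK /=; apply.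
by apply: (@lexmin_sub i.+1 n.+1) => //; have := ltn_ord i; lia.
Qed.

Lemma definable_lexmin j i k :
  definable (fun rho : nat -> R => lexmin j (rho i) (block n k rho)).
Proof.
elim: j i k => [|j IH] i k; first exact: level_def.
(* The quantified block starts beyond variable [i] and block [k], so that updating it changes
   neither. *)
pose l := maxn i.+1 (k + n).
apply: (@definable_ext _ (fun rho => lexmin j (rho i) (block n k rho) /\
  forall y : 'rV[R]_n, (fun rho => lexmin j (rho i) (block n l rho) ->
     stage j (block n k rho) <= stage j (block n l rho)) (updv rho l y))).
  move=> rho; rewrite /= /argmin /=.
  have ik (y : 'rV[R]_n) : updv rho l y i = rho i by apply: updv_out; exact: leq_maxl.
  have kk (y : 'rV[R]_n) : block n k (updv rho l y) = block n k rho.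
    by apply: block_updv_out; exact: leq_maxr.
  by split=> -[xt xmin]; split => // y; have := xmin y; rewrite block_updv ik kk.
have step := definable_le (polyfun_stage j k) (polyfun_stage j l).
exact: (definable_and (IH i k) (definable_allv n l (definable_imp (IH i l) step))).
Qed.

(** By [lexmin_unique] the witnesses are the lexicographically least minimizers at the levels
    [rho i] and [rho j]: this is the comparison of [u] along the curve, as [eventually_monotone]
    requires it. *)
Lemma definable_compare (u : 'rV[R]_n -> R) :
  (forall k, polyfun (fun rho : nat -> R => u (block n k rho))) ->
  forall i j, definable (fun rho : nat -> R => exists x, lexmin n.+1 (rho i) x /\
    exists y, lexmin n.+1 (rho j) y /\ u x < u y).
Proof.
move=> u_poly i j; pose k := maxn i.+1 j.+1; pose l := (k + n)%N.
apply: (@definable_ext _ (fun rho => exists x : 'rV[R]_n,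
  (fun rho => lexmin n.+1 (rho i) (block n k rho) /\
    exists y : 'rV[R]_n, (fun rho => lexmin n.+1 (rho j) (block n l rho) /\
       u (block n k rho) < u (block n l rho)) (updv rho l y)) (updv rho k x))).
  have ik rho (x : 'rV[R]_n) : updv rho k x i = rho i by apply: updv_out; rewrite leq_maxl.
  have jk rho (x : 'rV[R]_n) : updv rho k x j = rho j by apply: updv_out; rewrite leq_maxr.
  have jl rho (x : 'rV[R]_n) : updv rho l x j = rho j.
    by apply: updv_out; apply: leq_trans (leq_addr _ _); rewrite leq_maxr.
  have kl rho (y : 'rV[R]_n) : block n k (updv rho l y) = block n k rho by apply: block_updv_out.
  move=> rho; split=> -[x [xi [y yP]]]; exists x; split.
  - by move: xi; rewrite ik block_updv.
  - by exists y; move: yP; rewrite jl jk block_updv kl block_updv.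
  - by rewrite ik block_updv.
  - by exists y; rewrite jl jk block_updv kl block_updv.
have lt_def := definable_lt (u_poly k) (u_poly l).
have inner := definable_exv n l (definable_and (definable_lexmin n.+1 j l) lt_def).
exact: (definable_exv n k (definable_and (definable_lexmin n.+1 i k) inner)).
Qed.

(** * Estimates along a curve of minimizers with monotone coordinates *)

Section Curve.
Variables (c : R -> 'rV[R]_n) (d : R) (sg : 'I_n -> R).
Hypothesis cP : forall t, 0 < t < d -> lexmin n.+1 t (c t).
Hypothesis sgP : forall i, `|sg i| = 1.
Hypothesis c_mono : forall i s t, 0 < s -> s < t -> t < d ->
  sg i * c s 0 i <= sg i * c t 0 i.

(** Each [sg i] is the direction in which coordinate [i] moves, so that an increment of this
    function is the sum of the absolute increments of the coordinates of [c]. *)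
Definition variation t := \sum_i sg i * c t 0 i.

Lemma norm_curve s t : 0 < s -> s < t -> t < d ->
  `|c t - c s| <= variation t - variation s.
Proof.
move=> s0 st td; rewrite /variation -sumrB; apply: norm_le_coord.
  by apply: sumr_ge0 => i _; rewrite subr_ge0 c_mono.
move=> i; rewrite (bigD1 i) //= ler_wpDr //.
  by apply: sumr_ge0 => j _; rewrite subr_ge0 c_mono.
rewrite -mulrBr -[leLHS]mul1r -(sgP i) -normrM ger0_norm ?mxE //.
by rewrite mulrBr subr_ge0 c_mono.
Qed.

(** As [F (c t) = t], the slope hypothesis bounds [t - s] by [L * (kappa * D + D ^+ 2)], with [D]
    the increment of [variation]. This yields the claim for [s] close to [t], and [local_to_global]
    extends it to [a] and [b]; continuity of [c] is never invoked. *)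
Lemma curve_slope a b kappa : 0 < kappa -> 0 < a -> a < b -> b < d ->
  (forall t, 0 < t <= b -> W (c t) <= kappa ^+ 2) ->
  b - a <= 2 * L * kappa * (variation b - variation a).
Proof.
move=> k0 a0 ab bd Wk.
have FcE t : 0 < t < d -> S (c t) /\ F (c t) = t.
  by move=> /cP; apply: (@lexmin_sub 0).
have step s t r : 0 < s -> s < t -> t <= b -> (r = s \/ r = t) ->
    t - s <= 2 * L * kappa ^+ 2 ->
    t - s <= 2 * L * kappa * (variation t - variation s).
  move=> s0 st tb rst small.
  have [Ss Fs] : S (c s) /\ F (c s) = s by apply: FcE; lra.
  have [St Ft] : S (c t) /\ F (c t) = t by apply: FcE; lra.
  have nD : `|c t - c s| <= variation t - variation s by apply: norm_curve; lra.
  have sqk r' : 0 < r' <= b -> Num.sqrt (W (c r')) <= kappa.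
    by move=> /Wk h; rewrite -[leRHS]gtr0_norm // -sqrtr_sqr ler_wsqrtr.
  have : t - s <= L * (kappa * `|c t - c s| + `|c t - c s| ^+ 2).
    have -> : t - s = `|F (c t) - F (c s)| by rewrite Ft Fs gtr0_norm; lra.
    case: rst => _.
      apply: le_trans (F_slope Ss St) _; rewrite ler_wpM2l ?(ltW L_gt0) //.
      by rewrite lerD2r ler_wpM2r // sqk //; lra.
    rewrite distrC [X in L * (kappa * X + _)]distrC [X in L * (_ + X ^+ 2)]distrC.
    apply: le_trans (F_slope St Ss) _; rewrite ler_wpM2l ?(ltW L_gt0) //.
    by rewrite lerD2r ler_wpM2r // sqk //; lra.
  set D := variation t - variation s in nD *.
  have n0 : 0 <= `|c t - c s| by [].
  set e := `|c t - c s| in nD n0 * => h.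
  have D0 : 0 <= D by lra.
  have {}h : t - s <= L * (kappa * D + D ^+ 2).
    apply: le_trans h _; rewrite ler_wpM2l ?(ltW L_gt0) //.
    by rewrite lerD ?ler_wpM2l ?ler_pXn2r ?nnegrE ?(ltW k0).
  have [Dk|Dk] := leP D kappa.
    apply: le_trans h _; rewrite [leRHS](_ : _ = L * (kappa * D + kappa * D)); last ring.
    by rewrite ler_wpM2l ?(ltW L_gt0) // lerD2l expr2 ler_wpM2r.
  (* If [kappa < D], as may happen across a jump of [c], closeness of [s] and [t] is enough:
     [2 * L * kappa ^+ 2] is already below the bound. *)
  apply: le_trans small _; rewrite expr2 mulrA ler_wpM2l ?(ltW Dk) //.
  by rewrite !mulr_ge0 // ltW.
have k20 : 0 < 2 * L * kappa ^+ 2 by rewrite !mulr_gt0 // exprn_gt0.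
apply: (@local_to_global _ (fun s t => t - s <= 2 * L * kappa * (variation t - variation s))) => //.
- by move=> r s t h1 h2; have := lerD h1 h2; rewrite -mulrDr; lra.
- move=> t /andP[at_ tb]; near=> s.
  have ts : t < s by near: s; exact: nbhs_right_gt.
  have sb : s < b by near: s; exact: nbhs_right_lt.
  have sk : s < t + 2 * L * kappa ^+ 2 by near: s; apply: nbhs_right_lt; rewrite ltrDl.
  by apply: (step t s t); [lra|lra|lra|left|lra].
- move=> t /andP[at_ tb]; near=> s.
  have ts : s < t by near: s; exact: nbhs_left_lt.
  have sb : a < s by near: s; exact: nbhs_left_gt.
  have sk : t - 2 * L * kappa ^+ 2 < s by near: s; apply: nbhs_left_gt; lra.
  by apply: (step s t t); [lra|lra|lra|right|lra].
Unshelve. all: by end_near. Qed.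

(** The point [c (F x)] minimizes [W] on the level of [x], and [W] is nondecreasing along [c]; so
    [curve_slope] applies with [kappa] the square root of [W x]. *)
Lemma curve_desingularizes :
  (forall s t, 0 < s -> s < t -> t < d -> W (c s) <= W (c t)) ->
  forall x s, S x -> 0 < F x < d -> 0 < s < F x ->
    F x - s <= Num.sqrt (W x) * (2 * L * variation (F x) - 2 * L * variation s).
Proof.
move=> W_mono x s Sx /andP[b0 bd] /andP[s0 sb]; set b := F x in b0 bd sb *.
have cbx : W (c b) <= W x.
  have : lexmin 1 b (c b) by apply: lexmin_sub (cP _); rewrite // b0.
  by case=> _; apply.
have Wb t : 0 < t <= b -> W (c t) <= W x.
  move=> /andP[t0]; rewrite le_eqVlt => /orP[/eqP->//|tb].
  by apply: le_trans cbx; apply: W_mono.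
have [W0|W0] := ltP 0 (W x).
  have k0 : 0 < Num.sqrt (W x) by rewrite sqrtr_gt0.
  have := @curve_slope s b _ k0 s0 sb bd; rewrite sqr_sqrtr ?(ltW W0) //.
  by move=> /(_ Wb); rewrite -mulrBr [2 * L * _]mulrC !mulrA.
exfalso; set D := variation b - variation s.
have D0 : 0 <= D by apply: le_trans (norm_curve s0 sb bd).
(* If [W x <= 0], every positive [kappa] is admissible; this one makes the bound of [curve_slope]
   smaller than [b - s]. *)
pose kappa := (b - s) / (2 * (2 * L * D + 1)).
have LD : 0 <= 2 * L * D by rewrite !mulr_ge0 // ltW.
have k0 : 0 < kappa by rewrite divr_gt0 ?mulr_gt0 //; lra.
have := @curve_slope s b _ k0 s0 sb bd; rewrite -/D => slope.
have : b - s <= 2 * L * kappa * D.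
  apply: slope => t /Wb h; apply: le_trans h (le_trans W0 _).
  exact: sqr_ge0.
have kE : kappa * (2 * (2 * L * D + 1)) = b - s.
  by rewrite divfK // gt_eqF // mulr_gt0; lra.
have := mulr_ge0 (ltW k0) LD; clearbody kappa; lra.
Qed.

End Curve.

(** An integrated Kurdyka-Lojasiewicz inequality: differences of [Psi] stand for its derivative, so
    that [Psi] may jump, and its boundedness is what a telescoping sum needs. *)
Theorem desingularization : exists d (Psi : R -> R) M,
  [/\ 0 < d, forall t, 0 < t < d -> `|Psi t| <= M &
   forall x s, S x -> 0 < F x < d -> 0 < s < F x ->
     F x - s <= Num.sqrt (W x) * (Psi (F x) - Psi s)].
Proof.
have : definable (fun rho : nat -> R => exists x, lexmin 0 (rho 0%N) x).
  apply: (@definable_ext _ (fun rho => exists x : 'rV[R]_n,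
    (fun rho => lexmin 0 (rho 0%N) (block n 1 rho)) (updv rho 1 x))).
    by move=> rho; split=> -[x xP]; exists x; move: xP; rewrite updv_out ?block_updv.
  exact: (definable_exv n 1 (definable_lexmin 0 0 1)).
move=> /(tame_right [::] 0 0)[]; rewrite /upd /= => /near_rightP[d0 [d00 dP]]; last first.
  (* No level in []0, d0[] is attained, so the inequality is vacuous. *)
  exists d0, (fun=> 0), 0; split => // [t _|x s Sx /andP[Fx0 Fxd] _].
    by rewrite normr0.
  by case: (dP (F x)); rewrite ?add0r ?Fx0 //; exists x.
have {}dP t : 0 < t < d0 -> lexmin n.+1 t !=set0.
  by move=> td; apply: lexmin_neq0; apply: dP; rewrite add0r.
have /choice[c cP] : forall t, exists x, 0 < t < d0 -> lexmin n.+1 t x.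
  move=> t; have [/dP[x xt]|tN] := pselect (0 < t < d0); first by exists x.
  by exists 0.
have mono (u : 'rV[R]_n -> R) :
    (forall k, polyfun (fun rho : nat -> R => u (block n k rho))) ->
    exists s, `|s| = 1 /\ \forall d \near 0^'+, forall a b, 0 < a -> a < b -> b < d ->
      s * u (c a) <= s * u (c b).
  move=> up; have [|d [dgt0 _ dmono]] := @eventually_monotone _ (fun t => u (c t))
      (fun s t => exists x, lexmin n.+1 s x /\ exists y, lexmin n.+1 t y /\ u x < u y)
      d0 d00 (definable_compare up).
    move=> s t /cP cs /cP ct; split; last by move=> ?; exists (c s); split => //; exists (c t).
    by move=> [x [/lexmin_unique/(_ cs)-> [y [/lexmin_unique/(_ ct)->]]]].
  case: dmono => dmono; [exists 1|exists (-1)]; rewrite ?normrN normr1; split=> //;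
    near=> e => a b a0 ab be; rewrite ?mul1r ?mulN1r ?lerN2; apply: dmono => //;
    by apply: lt_trans be _; near: e; apply: nbhs_right_lt.
have /choice[sg sgP] : forall i : 'I_n, exists s, `|s| = 1 /\
    \forall d \near 0^'+, forall a b, 0 < a -> a < b -> b < d ->
      s * c a 0 i <= s * c b 0 i.
  by move=> i; apply: (mono (fun x => x 0 i)) => k; exact: polyfun_block.
have [w [w1 wmono]] := mono W W_poly.
have sg_near : \forall d \near 0^'+, forall i a b, 0 < a -> a < b -> b < d ->
    sg i * c a 0 i <= sg i * c b 0 i.
  by apply: filter_forall => i; have [] := sgP i.
have [d [dgt0 dd0 sgd wd]] : exists d, [/\ 0 < d, d <= d0,
    forall i a b, 0 < a -> a < b -> b < d -> sg i * c a 0 i <= sg i * c b 0 i &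
    forall a b, 0 < a -> a < b -> b < d -> w * W (c a) <= w * W (c b)].
  suff: \forall d \near 0^'+, [/\ 0 < d, d <= d0,
    forall i a b, 0 < a -> a < b -> b < d -> sg i * c a 0 i <= sg i * c b 0 i &
    forall a b, 0 < a -> a < b -> b < d -> w * W (c a) <= w * W (c b)].
    by move=> /filter_ex[d]; exists d.
  near=> d; split; [by []|by near: d; exact: nbhs_right_le|by near: d|by near: d].
have cPd t : 0 < t < d -> lexmin n.+1 t (c t) by move=> ?; apply: cP; lra.
have [M [Mreal SM]] := compact_bounded S_cpt.
have Vbound t : 0 < t < d -> `|2 * L * variation c sg t| <= 2 * L * (n%:R * (`|M| + 1)).
  move=> td; have [Sc _] := lexmin_sub (leq0n _) (cPd t td).
  rewrite normrM [`|2 * L|]ger0_norm ?mulr_ge0 ?(ltW L_gt0) // ler_wpM2l ?mulr_ge0 ?(ltW L_gt0) //.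
  apply: le_trans (ler_norm_sum _ _ _) _.
  have -> : n%:R * (`|M| + 1) = \sum_(i < n) (`|M| + 1).
    by rewrite sumr_const card_ord mulr_natl.
  apply: ler_sum => i _; rewrite normrM (sgP i).1 mul1r.
  apply: le_trans (coord_le_norm _ _) _; apply: SM => //.
  by rewrite (le_lt_trans (ler_norm _)) // ltrDl.
have final d' : 0 < d' -> d' <= d ->
    (forall s t, 0 < s -> s < t -> t < d' -> W (c s) <= W (c t)) ->
    exists d (Psi : R -> R) M,
  [/\ 0 < d, forall t, 0 < t < d -> `|Psi t| <= M &
   forall x s, S x -> 0 < F x < d -> 0 < s < F x ->
     F x - s <= Num.sqrt (W x) * (Psi (F x) - Psi s)].
  move=> d'0 d'd Wd'.
  exists d', (fun t => 2 * L * variation c sg t), (2 * L * (n%:R * (`|M| + 1))).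
  split => // [t td|]; first by apply: Vbound; lra.
  apply: curve_desingularizes => //.
  - by move=> t td; apply: cPd; lra.
  - by move=> i; exact: (sgP i).1.
  - by move=> i s t s0 st td; apply: sgd => //; lra.
have : w = 1 \/ w = -1.
  have := normr0P; have [w0|w0] := ltP w 0; [right|left].
    by rewrite ltr0_norm // in w1; lra.
  by rewrite ger0_norm // in w1.
case=> wE; rewrite wE in wd.
  by apply: (final d) => // s t s0 st td; have := wd _ _ s0 st td; rewrite !mul1r.
have {}wd a b : 0 < a -> a < b -> b < d -> W (c b) <= W (c a).
  by move=> a0 ab bd; have := wd _ _ a0 ab bd; rewrite !mulN1r lerN2.
(* Here [W] is nonincreasing along [c]. If it is positive nowhere on the curve, it vanishes there
   and is nondecreasing as well. *)
have [[t [td Wt]]|Wn] := pselect (exists t, 0 < t < d /\ 0 < W (c t)); last first.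
  apply: (final d) => // s t s0 st td.
  have h : ~ 0 < W (c s) by move=> Ws; apply: Wn; exists s; split => //; lra.
  by apply: le_trans (W_ge0 _); rewrite leNgt; apply/negP.
(* On the levels below [t], [W] is at least [W (c t) > 0], so a linear [Psi] does. *)
exists t, (fun s => s / Num.sqrt (W (c t))), (t / Num.sqrt (W (c t))).
have sW : 0 < Num.sqrt (W (c t)) by rewrite sqrtr_gt0.
split; first lra.
  move=> s sd; rewrite ger0_norm; last by rewrite divr_ge0 ?(ltW sW) //; lra.
  by rewrite ler_pM2r ?invr_gt0 //; lra.
move=> x s Sx /andP[Fx0 Fxt] /andP[s0 sF].
rewrite -mulrBl mulrCA -[leLHS]mulr1; apply: ler_wpM2l; first lra.
rewrite ler_pdivlMr // mul1r ler_wsqrtr //.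
have cbx : W (c (F x)) <= W x.
  have : lexmin 1 (F x) (c (F x)) by apply: lexmin_sub (cPd _ _); rewrite //; lra.
  by case=> _; apply.
by apply: le_trans cbx; apply: wd => //; lra.
Unshelve. all: by end_near. Qed.

End KurdykaLojasiewicz.

(** * Polynomial maps *)

Section PolynomialMaps.
Variables (R : realType) (n : nat).
Implicit Types (F : 'rV[R]_n -> R) (G : 'rV[R]_n -> 'rV[R]_n) (x y u v : 'rV[R]_n).

Definition dot u v : R := \sum_i u 0 i * v 0 i.

Lemma mulmx_dot u v : (u *m v^T) 0 0 = dot u v.
Proof. by rewrite mxE; apply: eq_bigr => i _; rewrite mxE. Qed.

Lemma dotC u v : dot u v = dot v u.
Proof. by apply: eq_bigr => i _; rewrite mulrC. Qed.

Lemma dotDl u v w : dot (u + v) w = dot u w + dot v w.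
Proof. by rewrite -big_split; apply: eq_bigr => i _; rewrite mxE mulrDl. Qed.

Lemma dotZl a u v : dot (a *: u) v = a * dot u v.
Proof. by rewrite mulr_sumr; apply: eq_bigr => i _; rewrite mxE mulrA. Qed.

Lemma dotNl u v : dot (- u) v = - dot u v.
Proof. by rewrite -scaleN1r dotZl mulN1r. Qed.

Lemma dot0l v : dot 0 v = 0.
Proof. by rewrite /dot big1 // => i _; rewrite mxE mul0r. Qed.

Lemma dotDr u v w : dot w (u + v) = dot w u + dot w v.
Proof. by rewrite !(dotC w) dotDl. Qed.

Lemma dotZr a u v : dot v (a *: u) = a * dot v u.
Proof. by rewrite !(dotC v) dotZl. Qed.

Lemma dot_delta u i : dot u (delta_mx 0 i) = u 0 i.
Proof.
rewrite /dot (bigD1 i) //= mxE !eqxx mulr1 big1 ?addr0 // => j ji.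
by rewrite mxE eqxx (negPf ji) mulr0.
Qed.

Lemma dot_le u v : `|dot u v| <= n%:R * (`|u| * `|v|).
Proof.
apply: le_trans (ler_norm_sum _ _ _) _.
have -> : n%:R * (`|u| * `|v|) = \sum_(i < n) `|u| * `|v|.
  by rewrite sumr_const card_ord mulr_natl.
by apply: ler_sum => i _; rewrite normrM ler_pM // coord_le_norm.
Qed.

Lemma dot_self_ge0 u : 0 <= dot u u.
Proof. by apply: sumr_ge0 => i _; rewrite -expr2 sqr_ge0. Qed.

Lemma enorm_sqr u : enorm u ^+ 2 = dot u u.
Proof. by rewrite /enorm mulmx_dot sqr_sqrtr // dot_self_ge0. Qed.

Lemma enorm_ge0 u : 0 <= enorm u.
Proof. exact: sqrtr_ge0. Qed.

Lemma norm_le_enorm u : `|u| <= enorm u.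
Proof.
apply: norm_le_coord; first exact: enorm_ge0.
move=> i; rewrite -sqrtr_sqr /enorm mulmx_dot ler_wsqrtr //.
rewrite /dot (bigD1 i) //= -expr2 lerDl.
by apply: sumr_ge0 => j _; rewrite -expr2 sqr_ge0.
Qed.

Lemma enorm_le_norm u : enorm u <= n%:R * `|u|.
Proof.
have [->|u0] := eqVneq u 0.
  by rewrite /enorm mulmx_dot dot0l sqrtr0 normr0 mulr0.
have n1 : (1 : R) <= n%:R.
  rewrite ler1n lt0n; apply: contra_neq u0 => n0; apply/rowP => -[i]; lia.
rewrite -(ler_pXn2r (n := 2)) ?nnegrE ?enorm_ge0 ?mulr_ge0 //.
rewrite enorm_sqr; apply: le_trans (ler_norm _) _; apply: le_trans (dot_le _ _) _.
by rewrite exprMn -expr2 ler_wpM2r ?sqr_ge0 // expr2 ler_peMl // (le_trans ler01).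
Qed.

(** An inductive description, from which definability and Taylor bounds each follow by one
    induction; continuity comes from the latter. *)
Inductive polynomial_map : ('rV[R]_n -> R) -> Prop :=
| pm_const c : polynomial_map (fun _ => c)
| pm_coord i : polynomial_map (fun x => x 0 i)
| pm_add F1 F2 : polynomial_map F1 -> polynomial_map F2 ->
    polynomial_map (fun x => F1 x + F2 x)
| pm_mul F1 F2 : polynomial_map F1 -> polynomial_map F2 ->
    polynomial_map (fun x => F1 x * F2 x).

Lemma pm_sub F1 F2 : polynomial_map F1 -> polynomial_map F2 ->
  polynomial_map (fun x => F1 x - F2 x).
Proof.
move=> p1 p2; under eq_fun do rewrite -mulN1r.
by apply: pm_add => //; apply: pm_mul => //; exact: pm_const.
Qed.

Lemma pm_sum (I : Type) (r : seq I) (F : I -> 'rV[R]_n -> R) :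
  (forall a, polynomial_map (F a)) -> polynomial_map (fun x => \sum_(a <- r) F a x).
Proof.
move=> pF; elim: r => [|a r IH].
  by under eq_fun do rewrite big_nil; exact: pm_const.
by under eq_fun do rewrite big_cons; exact: pm_add.
Qed.

Lemma pm_prod (I : Type) (r : seq I) (F : I -> 'rV[R]_n -> R) :
  (forall a, polynomial_map (F a)) -> polynomial_map (fun x => \prod_(a <- r) F a x).
Proof.
move=> pF; elim: r => [|a r IH].
  by under eq_fun do rewrite big_nil; exact: pm_const.
by under eq_fun do rewrite big_cons; exact: pm_mul.
Qed.

Lemma pm_dot : polynomial_map (fun x => dot x x).
Proof. by apply: pm_sum => i; apply: pm_mul; exact: pm_coord. Qed.

Lemma pm_tensor_form m (A : tensor R m n) : polynomial_map (tensor_form A).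
Proof.
apply: pm_sum => t; apply: pm_mul; first exact: pm_const.
by apply: pm_prod => j; exact: pm_coord.
Qed.

Lemma pm_tensor_vec m (A : tensor R m.+1 n) i :
  polynomial_map (fun x => tensor_vec A x 0 i).
Proof.
under eq_fun do rewrite mxE.
apply: pm_sum => t; apply: pm_mul; first exact: pm_const.
by apply: pm_prod => j; exact: pm_coord.
Qed.

Lemma polyfun_pm F : polynomial_map F ->
  forall k, polyfun (fun rho : nat -> R => F (block n k rho)).
Proof.
move=> pF k; elim: pF => [c|i|F1 F2 _ p1 _ p2|F1 F2 _ p1 _ p2].
- exact: polyfun_const.
- exact: polyfun_block.
- exact: polyfunD.
- exact: polyfunM.
Qed.

(** Second-order expansion with gradient [G], uniform on each ball. The bounds on values and
    increments are carried along for the case of products. *)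
Definition taylor2 F G := forall r : R, exists2 C, 0 <= C &
  forall x y, `|x| <= r -> `|y| <= r ->
  [/\ `|F x| <= C, `|F y - F x| <= C * `|y - x| &
      `|F y - F x - dot (G x) (y - x)| <= C * `|y - x| ^+ 2].

Lemma taylor2_pm F : polynomial_map F -> exists G, taylor2 F G.
Proof.
elim=> [c|i|F1 F2 _ [G1 T1] _ [G2 T2]|F1 F2 _ [G1 T1] _ [G2 T2]].
- exists (fun=> 0) => r; exists `|c| => // x y _ _.
  by rewrite subrr dot0l subr0 normr0; split=> //; rewrite mulr_ge0 ?exprn_ge0.
- exists (fun=> delta_mx 0 i) => r; exists (Num.max 1 r).
    by rewrite le_max ler01.
  move=> x y xr yr; have -> : y 0 i - x 0 i = (y - x) 0 i by rewrite !mxE.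
  rewrite dotC dot_delta subrr normr0.
  have m0 : 0 <= Num.max 1 r by rewrite le_max ler01.
  split.
  + by apply: le_trans (coord_le_norm _ _) _; rewrite le_max xr orbT.
  + apply: le_trans (coord_le_norm _ _) _.
    by rewrite ler_peMl // le_max lexx.
  + by rewrite mulr_ge0 ?exprn_ge0.
- exists (fun x => G1 x + G2 x) => r.
  have [C1 C10 E1] := T1 r; have [C2 C20 E2] := T2 r.
  exists (C1 + C2) => [|x y xr yr]; first exact: addr_ge0.
  have [a1 b1 c1] := E1 _ _ xr yr; have [a2 b2 c2] := E2 _ _ xr yr.
  rewrite !mulrDl; split.
  + exact: le_trans (ler_normD _ _) (lerD _ _).
  + apply: le_trans (lerD b1 b2); apply: le_trans (ler_normD _ _).
    by rewrite opprD addrACA.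
  + apply: le_trans (lerD c1 c2); apply: le_trans (ler_normD _ _).
    by rewrite dotDl; set l1 := dot (G1 x) _; set l2 := dot (G2 x) _;
      rewrite le_eqVlt; apply/orP; left; apply/eqP; congr `|_|; ring.
- exists (fun x => F1 x *: G2 x + F2 x *: G1 x) => r.
  have [C1 C10 E1] := T1 r; have [C2 C20 E2] := T2 r.
  have C0 := mulr_ge0 C10 C20.
  exists (3 * (C1 * C2)) => [|x y xr yr]; first by rewrite mulr_ge0.
  have [a1 b1 c1] := E1 _ _ xr yr; have [a2 b2 c2] := E2 _ _ xr yr.
  have [a2' _ _] := E2 _ _ yr xr.
  set d := `|y - x| in b1 c1 b2 c2 *; have d0 : 0 <= d by exact: normr_ge0.
  split.
  + rewrite normrM; apply: le_trans (ler_pM _ _ a1 a2) _ => //.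
    by rewrite ler_peMl //; lra.
  + have -> : F1 y * F2 y - F1 x * F2 x = (F1 y - F1 x) * F2 y + F1 x * (F2 y - F2 x).
      by ring.
    apply: le_trans (ler_normD _ _) _; rewrite !normrM.
    have := ler_pM (normr_ge0 _) (normr_ge0 _) b1 a2'.
    have := ler_pM (normr_ge0 _) (normr_ge0 _) a1 b2.
    by have := mulr_ge0 C0 d0; lra.
  + rewrite dotDl !dotZl; set l1 := dot (G1 x) _ in c1 *; set l2 := dot (G2 x) _ in c2 *.
    (* The remainder of a product: each remainder times the other value, plus the product of the
       increments. *)
    have -> : F1 y * F2 y - F1 x * F2 x - (F1 x * l2 + F2 x * l1) =
      F1 x * (F2 y - F2 x - l2) + F2 x * (F1 y - F1 x - l1) +
      (F1 y - F1 x) * (F2 y - F2 x) by ring.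
    apply: le_trans (ler_normD _ _) _.
    apply: le_trans (lerD (ler_normD _ _) (lexx _)) _; rewrite !normrM.
    have := ler_pM (normr_ge0 _) (normr_ge0 _) b1 b2.
    have := ler_pM (normr_ge0 _) (normr_ge0 _) a1 c2.
    have := ler_pM (normr_ge0 _) (normr_ge0 _) a2 c1.
    by lra.
Qed.

Lemma continuous_pm F : polynomial_map F -> continuous F.
Proof.
move=> /taylor2_pm[G T] x; have [C C0 TC] := T (`|x| + 1).
have xr : `|x| <= `|x| + 1 by rewrite lerDl.
have near_dist (e : R) : 0 < e -> \forall y \near x, `|x - y| < e.
  move=> e0; apply/nbhs_ballP; exists e => //= y; by rewrite mx_norm_ball.
apply/(@cvgrPdist_lt R R _ (nbhs x)) => e e0.
have d0 : 0 < Num.min 1 (e / (C + 1)) by rewrite lt_min ltr01 divr_gt0 //; lra.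
apply: filterS (near_dist _ d0) => y; rewrite lt_min => /andP[xy1 xye].
have yr : `|y| <= `|x| + 1.
  rewrite -[y](subrK x) addrC; apply: le_trans (ler_normD _ _) _; rewrite lerD2l.
  by rewrite distrC ltW.
have [_ h _] := TC _ _ xr yr; rewrite distrC; apply: le_lt_trans h _.
move: xye; rewrite distrC ltr_pdivlMr; last lra.
by apply: le_lt_trans; rewrite mulrC ler_wpM2l //; lra.
Qed.

(** This identifies the unspecified gradient produced by [taylor2_pm] with the partial derivatives
    computed for tensor forms. *)
Lemma taylor2_derive F G x v : taylor2 F G -> is_derive x v F (dot (G x) v).
Proof.
move=> T; have [C C0 TC] := T (`|x| + `|v|).
suff cv : h^-1 *: ((F \o shift x) (h *: v) - F x) @[h --> 0^'] --> dot (G x) v.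
  by apply: DeriveDef; [exact: cvgP cv|exact: cvg_lim cv].
apply/cvgrPdist_lt => e e0; near=> h.
have h0 : h != 0 by near: h; exact: nbhs_dnbhs_neq.
have h1 : `|h| < Num.min 1 (e / (C * `|v| ^+ 2 + 1)).
  near: h; apply: (@dnbhs0_lt R R); rewrite lt_min ltr01 divr_gt0 //.
  by rewrite ltr_wpDl // mulr_ge0 ?exprn_ge0.
move: h1; rewrite lt_min => /andP[h1 he].
have [|| _ _] := TC x (h *: v + x); first by rewrite lerDl.
  rewrite addrC; apply: le_trans (ler_normD _ _) _; rewrite lerD2l normrZ.
  by rewrite ler_piMl // ltW.
rewrite addrK dotZr => hT.
rewrite distrC /= /GRing.scale /= -(mulKf h0 (dot (G x) v)) -mulrBr normrM.
rewrite normfV mulrC ltr_pdivrMr ?normr_gt0 //; apply: le_lt_trans hT _.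
rewrite normrZ.
have -> : C * (`|h| * `|v|) ^+ 2 = (`|h| * (C * `|v| ^+ 2)) * `|h| by ring.
rewrite ltr_pM2r ?normr_gt0 //.
have V0 : 0 <= C * `|v| ^+ 2 by rewrite mulr_ge0 ?exprn_ge0.
move: he; rewrite ltr_pdivlMr ?ltr_wpDl //; apply: le_lt_trans.
by rewrite ler_wpM2l // lerDl.
Unshelve. all: by end_near. Qed.

End PolynomialMaps.

(** * Quotients of tensor forms on the sphere *)

Section TensorForms.
Variables (R : realType) (n m : nat).
Implicit Types (A : tensor R m.+1 n) (x : 'rV[R]_n).

(** Euler's identity for homogeneous forms: the first index of the sum is split off. *)
Lemma dot_tensor_vec A x : dot (tensor_vec A x) x = tensor_form A x.
Proof.
pose h (u : 'I_n * m.-tuple 'I_n) := [tuple of u.1 :: u.2].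
pose h' (t : m.+1.-tuple 'I_n) := (thead t, [tuple of behead t]).
have hK : cancel h h' by case=> a u; congr (_, _); apply: val_inj.
have h'K : cancel h' h by move=> t; rewrite [RHS]tuple_eta; apply: val_inj.
rewrite /tensor_form (reindex h) /=; last by exists h' => ? _.
rewrite -(pair_bigA _ (fun a u => A (h (a, u)) * \prod_(j < m.+1) x 0 (tnth (h (a, u)) j))).
rewrite /dot; apply: eq_bigr => i _; rewrite mxE mulr_suml; apply: eq_bigr => u _.
rewrite big_ord_recl /= tnth0 -mulrA; congr (_ * _); rewrite mulrC; congr (_ * _).
by apply: eq_bigr => j _; rewrite tnthS.
Qed.

Lemma taylor2_tensor_form A : symmetric_tensor A ->
  taylor2 (tensor_form A) (fun x => m.+1%:R *: tensor_vec A x).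
Proof.
move=> Asym; have [G GT] := taylor2_pm (pm_tensor_form A).
suff <- : G = fun x => m.+1%:R *: tensor_vec A x by [].
apply/funext => x; apply/rowP => i.
have dG := taylor2_derive x (delta_mx 0 i) GT.
have dA := is_derive_tensor_form x i Asym.
by rewrite -dot_delta -(@derive_val _ _ _ _ _ _ _ dG) derive_val [RHS]mxE.
Qed.

End TensorForms.

Section Quotient.
Variables (R : realType) (n m : nat) (H B : tensor R m.+1 n).
Hypotheses (H_sym : symmetric_tensor H) (B_sym : symmetric_tensor B).
Hypothesis B_pd : posdef_tensor B.
Implicit Types (x y : 'rV[R]_n).

Local Notation S := (@unit_sphere R n).
Local Notation f := (tensor_quotient H B).

Lemma sphere_dot x : S x <-> dot x x = 1.
Proof. by rewrite /unit_sphere /= mulmx_dot. Qed.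

Lemma sphere_norm x : S x -> `|x| <= 1.
Proof.
move=> /sphere_dot x1; apply: le_trans (norm_le_enorm _) _.
by rewrite /enorm mulmx_dot x1 sqrtr1.
Qed.

Lemma closed_pm (F : 'rV[R]_n -> R) c : polynomial_map F -> closed [set x | F x = c].
Proof.
move=> /continuous_pm Fc.
by apply: (closed_comp _ (@closed_eq R c)) => x _; exact: Fc.
Qed.

Lemma sphere_compact : compact S.
Proof.
apply: bounded_closed_compact.
  by exists 1; split => // M M1 x /sphere_norm x1; exact: le_trans x1 (ltW M1).
rewrite (_ : S = [set x | dot x x = 1]); first exact: closed_pm (pm_dot R n).
by apply/seteqP; split => x /sphere_dot.
Qed.

Lemma sphere_B_gt0 x : S x -> 0 < tensor_form B x.
Proof.
move=> /sphere_dot x1; apply: B_pd; apply: contra_eq_neq x1 => ->.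
by rewrite dot0l eq_sym oner_eq0.
Qed.

Lemma sphere_B_ge : exists2 b, 0 < b & forall x, S x -> b <= tensor_form B x.
Proof.
have [S0|] := pselect (S !=set0); last first.
  by move=> S0; exists 1 => // x Sx; case: S0; exists x.
have [|c /set_mem Sc cmin] := EVT_min_rV (f := tensor_form B) S0 sphere_compact.
  exact/continuous_subspaceT/continuous_pm/pm_tensor_form.
exists (tensor_form B c); first exact: sphere_B_gt0.
by move=> x Sx; apply: cmin; rewrite inE.
Qed.

(** The gradient of the quotient up to a positive factor, without denominators, so that its squared
    norm is polynomial. *)
Definition wronskian x : 'rV[R]_n :=
  tensor_form B x *: tensor_vec H x - tensor_form H x *: tensor_vec B x.

Definition sqr_wronskian x : R := dot (wronskian x) (wronskian x).

Lemma pm_wronskian i : polynomial_map (fun x => wronskian x 0 i).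
Proof.
rewrite (_ : (fun x => _) = fun x => tensor_form B x * tensor_vec H x 0 i -
    tensor_form H x * tensor_vec B x 0 i); last first.
  by apply/funext => x; rewrite /wronskian !mxE.
by apply: pm_sub; apply: pm_mul; do ?[exact: pm_tensor_form|exact: pm_tensor_vec].
Qed.

Lemma pm_sqr_wronskian : polynomial_map sqr_wronskian.
Proof. by apply: pm_sum => i; apply: pm_mul; exact: pm_wronskian. Qed.

Lemma grad_wronskian x : S x ->
  grad f x = (m.+1%:R / tensor_form B x ^+ 2) *: wronskian x.
Proof.
move=> Sx; have B0 := sphere_B_gt0 Sx.
rewrite grad_tensor_quotient ?gt_eqF // /wronskian.
apply/rowP => i; rewrite !mxE.
set a := (\sum_t _); set b := (\sum_t _).
by field; rewrite gt_eqF.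
Qed.

(** The quotient is homogeneous of degree [0], so its gradient is tangent to the sphere; Euler's
    identity makes the two terms cancel. *)
Lemma dot_grad x : S x -> dot (grad f x) x = 0.
Proof.
move=> Sx; rewrite grad_wronskian // dotZl /wronskian dotDl dotNl !dotZl.
by rewrite !dot_tensor_vec (mulrC (tensor_form B x)) subrr mulr0.
Qed.

Lemma norm_quot_le (z q Z q0 : R) : `|z| <= Z -> 0 < q0 -> q0 <= q ->
  `|z / q| <= Z / q0.
Proof.
move=> zZ q00 qq; have q1 := lt_le_trans q00 qq.
rewrite normrM normfV (gtr0_norm q1).
by rewrite ler_pM ?invr_ge0 ?(ltW q1) // lef_pV2.
Qed.

Lemma wronskian_bound : exists2 C, 0 <= C & forall x y, S x -> S y ->
  `|wronskian x| <= C /\ `|wronskian y - wronskian x| <= C * `|y - x|.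
Proof.
have /choice[C CP] : forall i : 'I_n, exists C, 0 <= C /\ forall x y, S x -> S y ->
    `|wronskian x 0 i| <= C /\ `|wronskian y 0 i - wronskian x 0 i| <= C * `|y - x|.
  move=> i; have [G T] := taylor2_pm (pm_wronskian i); have [C C0 TC] := T 1.
  by exists C; split => // x y /sphere_norm xS /sphere_norm yS; have [] := TC _ _ xS yS.
have Csum i : C i <= \sum_i C i.
  rewrite (bigD1 i) //= lerDl; apply: sumr_ge0 => j _; exact: (CP j).1.
have C0 : 0 <= \sum_i C i by apply: sumr_ge0 => j _; exact: (CP j).1.
exists (\sum_i C i) => // x y Sx Sy; split; apply: norm_le_coord => //.
- by move=> i; apply: le_trans (Csum i); have [] := (CP i).2 _ _ Sx Sy.
- by rewrite mulr_ge0.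
- move=> i; have [_ h] := (CP i).2 _ _ Sx Sy; rewrite !mxE in h *.
  by apply: le_trans h _; rewrite ler_wpM2r.
Qed.

(** The last bound expands, about [x], the numerator of [f y - f x] over the common denominator; its
    linear part is a multiple of the wronskian. *)
Lemma form_bound : exists2 C, 0 <= C & forall x y, S x -> S y ->
  [/\ `|tensor_form B x| <= C, `|tensor_form B y - tensor_form B x| <= C * `|y - x| &
   `|tensor_form H y * tensor_form B x - tensor_form H x * tensor_form B y -
     m.+1%:R * dot (wronskian x) (y - x)| <= C * `|y - x| ^+ 2].
Proof.
have [C1 C10 T1] := taylor2_tensor_form H_sym 1.
have [C2 C20 T2] := taylor2_tensor_form B_sym 1.
exists (C2 + 2 * (C1 * C2)) => [|x y /sphere_norm Sx /sphere_norm Sy].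
  by rewrite addr_ge0 // !mulr_ge0.
have [a1 b1 c1] := T1 _ _ Sx Sy; have [a2 b2 c2] := T2 _ _ Sx Sy.
have C0 : 0 <= C1 * C2 by rewrite mulr_ge0.
have d0 := normr_ge0 (y - x); set d := `|y - x| in b1 c1 b2 c2 d0 *.
have d20 : 0 <= d ^+ 2 by rewrite exprn_ge0.
split; first lra.
  by apply: le_trans b2 _; rewrite ler_wpM2r //; lra.
rewrite /wronskian dotDl dotNl !dotZl; rewrite !dotZl in c1 c2.
set l1 := dot (tensor_vec H x) _ in c1 *; set l2 := dot (tensor_vec B x) _ in c2 *.
set h := tensor_form H in a1 b1 c1 *; set b := tensor_form B in a2 b2 c2 *.
rewrite (_ : _ - _ = (h y - h x - m.+1%:R * l1) * b x - h x * (b y - b x - m.+1%:R * l2));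
  last by ring.
apply: le_trans (ler_normB _ _) _; rewrite !normrM.
have := ler_pM (normr_ge0 _) (normr_ge0 _) c1 a2.
have := ler_pM (normr_ge0 _) (normr_ge0 _) a1 c2.
have := mulr_ge0 C20 d20; lra.
Qed.

Lemma quotient_slope : exists2 L, 0 <= L & forall x y, S x -> S y ->
  `|f y - f x| <= L * (Num.sqrt (sqr_wronskian x) * `|y - x| + `|y - x| ^+ 2).
Proof.
have [C C0 CP] := form_bound; have [b b0 bB] := sphere_B_ge.
pose K := m.+1%:R * n%:R + C; have K0 : 0 <= K by rewrite addr_ge0 ?mulr_ge0.
exists (K / (b * b)) => [|x y Sx Sy]; first by rewrite divr_ge0 // mulr_ge0 // ltW.
have [_ _ h] := CP _ _ Sx Sy.
have [bx by_] := (sphere_B_gt0 Sx, sphere_B_gt0 Sy).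
have -> : f y - f x = (tensor_form H y * tensor_form B x -
    tensor_form H x * tensor_form B y) / (tensor_form B x * tensor_form B y).
  by rewrite /tensor_quotient; field; rewrite !gt_eqF.
rewrite (mulrAC K); apply: norm_quot_le; last first.
- by apply: ler_pM; rewrite ?(ltW b0) //; exact: bB.
- by rewrite mulr_gt0.
set N := dot _ _ in h; set e := _ - _ * N in h.
rewrite (_ : _ - _ = m.+1%:R * N + e); last by rewrite /e; ring.
have w : `|wronskian x| <= Num.sqrt (sqr_wronskian x).
  by rewrite /sqr_wronskian -enorm_sqr sqrtr_sqr ger0_norm ?enorm_ge0 // norm_le_enorm.
have N1 : `|N| <= n%:R * (Num.sqrt (sqr_wronskian x) * `|y - x|).
  by apply: le_trans (dot_le _ _) _; rewrite ler_wpM2l // ler_wpM2r.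
apply: le_trans (ler_normD _ _) _; rewrite normrM ger0_norm //.
have := ler_wpM2l (ler0n R m.+1) N1.
set s := Num.sqrt _ * _; have s0 : 0 <= s by rewrite mulr_ge0 ?sqrtr_ge0.
have d0 : 0 <= `|y - x| ^+ 2 by rewrite exprn_ge0.
have := mulr_ge0 C0 s0.
have : 0 <= m.+1%:R * n%:R * `|y - x| ^+ 2 by rewrite !mulr_ge0.
rewrite /K; move: h; set d := `|y - x| ^+ 2 in d0 *; lra.
Qed.

Lemma quotient_descent : exists2 L, 0 <= L & forall x y, S x -> S y ->
  f y <= f x + dot (grad f x) (y - x) + L * `|y - x| ^+ 2.
Proof.
have [C C0 CP] := form_bound; have [b b0 bB] := sphere_B_ge.
have [D D0 DP] := wronskian_bound.
pose K := m.+1%:R * (n%:R * D) * C; have K0 : 0 <= K by rewrite !mulr_ge0.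
exists (C / (b * b) + K / (b ^+ 2 * b)) => [|x y Sx Sy].
  by rewrite addr_ge0 ?divr_ge0 ?mulr_ge0 ?exprn_ge0 // ltW.
have [_ hb h] := CP _ _ Sx Sy; have [hD _] := DP _ _ Sx Sy.
have [bx by_] := (sphere_B_gt0 Sx, sphere_B_gt0 Sy).
rewrite grad_wronskian // dotZl /tensor_quotient.
set N := dot _ _ in h *; set e := _ - _ * N in h.
set d := `|y - x| in h hb *.
have N1 : `|N| <= n%:R * D * d.
  by apply: le_trans (dot_le _ _) _; rewrite mulrA ler_wpM2r // ler_wpM2l.
set b1 := tensor_form B x in bx hb e h *; set b2 := tensor_form B y in by_ hb e h *.
set h1 := tensor_form H x in e h *; set h2 := tensor_form H y in e h *.
(* Replacing [b1 * b2] by [b1 ^+ 2] under the linear term costs a second-order error, since [N] and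
   [b2 - b1] are both of order [d]. *)
have E : h2 / b2 = h1 / b1 + m.+1%:R / b1 ^+ 2 * N +
   (e / (b1 * b2) - m.+1%:R * N * (b2 - b1) / (b1 ^+ 2 * b2)).
  by rewrite /e; field; rewrite !gt_eqF.
rewrite E lerD2l; apply: le_trans (ler_norm _) _; apply: le_trans (ler_normB _ _) _.
rewrite [leRHS]mulrDl (mulrAC C) (mulrAC K); apply: lerD; apply: norm_quot_le => //.
- by rewrite mulr_gt0.
- by apply: ler_pM; rewrite ?(ltW b0) //; exact: bB.
- have -> : K * d ^+ 2 = m.+1%:R * (n%:R * D * d) * (C * d) by rewrite /K; ring.
  by rewrite !normrM ler_pM ?mulr_ge0 // ler_pM // ger0_norm.
- by rewrite mulr_gt0 ?exprn_gt0.
- by apply: ler_pM; rewrite ?exprn_ge0 ?(ltW b0) ?ler_pXn2r ?nnegrE ?(ltW b0) ?(ltW bx) ?bB.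
Qed.

Lemma grad_bound : exists2 L, 0 <= L & forall x, S x -> enorm (grad f x) <= L.
Proof.
have [b b0 bB] := sphere_B_ge; have [D D0 DP] := wronskian_bound.
exists (n%:R * (m.+1%:R / b ^+ 2 * D)) => [|x Sx].
  by rewrite !mulr_ge0 ?invr_ge0 ?exprn_ge0 // ltW.
have [hD _] := DP _ _ Sx Sx; have bx := sphere_B_gt0 Sx.
apply: le_trans (enorm_le_norm _) _; rewrite ler_wpM2l // grad_wronskian // normrZ.
rewrite ler_pM //; apply: norm_quot_le; rewrite ?exprn_gt0 //.
  by rewrite ger0_norm.
by rewrite ler_pXn2r ?nnegrE ?(ltW b0) ?(ltW bx) ?bB.
Qed.

Lemma grad_lipschitz : exists2 L, 0 <= L & forall x y, S x -> S y ->
  enorm (grad f y - grad f x) <= L * `|y - x|.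
Proof.
have [C C0 CP] := form_bound; have [b b0 bB] := sphere_B_ge.
have [D D0 DP] := wronskian_bound.
(* Over a common denominator, the two terms bound the change of the wronskian and that of the square
   of the form of [B]. *)
pose K := m.+1%:R * (D * C ^+ 2 + D * (2 * C ^+ 2)).
have K0 : 0 <= K by rewrite !mulr_ge0 ?addr_ge0 ?mulr_ge0 ?exprn_ge0.
exists (n%:R * (K / (b ^+ 2 * b ^+ 2))) => [|x y Sx Sy].
  by rewrite mulr_ge0 // divr_ge0 // mulr_ge0 // exprn_ge0 // ltW.
have [cx hb _] := CP _ _ Sx Sy; have [cy _ _] := CP _ _ Sy Sy.
have [hD hL] := DP _ _ Sx Sy.
have [bx by_] := (sphere_B_gt0 Sx, sphere_B_gt0 Sy).
apply: le_trans (enorm_le_norm _) _; rewrite -mulrA ler_wpM2l //.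
have bb1 : b ^+ 2 <= tensor_form B x ^+ 2.
  by rewrite ler_pXn2r ?nnegrE ?(ltW b0) ?(ltW bx) ?bB.
have bb2 : b ^+ 2 <= tensor_form B y ^+ 2.
  by rewrite ler_pXn2r ?nnegrE ?(ltW b0) ?(ltW by_) ?bB.
have d0 := normr_ge0 (y - x).
apply: norm_le_coord => [|i].
  by rewrite mulr_ge0 // divr_ge0 // mulr_ge0 // exprn_ge0 // ltW.
rewrite !grad_wronskian //.
have wx : `|wronskian x 0 i| <= D by apply: le_trans (coord_le_norm _ _) hD.
have wxy : `|wronskian y 0 i - wronskian x 0 i| <= D * `|y - x|.
  by apply: le_trans hL; apply: le_trans (coord_le_norm _ i); rewrite !mxE.
have coordE a1 a2 (u w : 'rV[R]_n) : (a1 *: u - a2 *: w) 0 i = a1 * u 0 i - a2 * w 0 i.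
  by rewrite !mxE.
rewrite coordE.
move: wx wxy; set w1 := wronskian x 0 i; set w2 := wronskian y 0 i => wx wxy.
set b1 := tensor_form B x in cx hb bx bb1 *; set b2 := tensor_form B y in cy hb by_ bb2 *.
set d := `|y - x| in d0 hb wxy *.
have -> : m.+1%:R / b2 ^+ 2 * w2 - m.+1%:R / b1 ^+ 2 * w1 =
   (m.+1%:R * ((w2 - w1) * b1 ^+ 2 - w1 * ((b2 - b1) * (b2 + b1)))) / (b1 ^+ 2 * b2 ^+ 2).
  by field; rewrite !gt_eqF.
rewrite (mulrAC K); apply: norm_quot_le; last 2 first.
- by rewrite mulr_gt0 ?exprn_gt0.
- by apply: ler_pM; rewrite ?exprn_ge0 ?(ltW b0).
rewrite normrM ger0_norm // /K -[leRHS]mulrA ler_wpM2l //.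
apply: le_trans (ler_normB _ _) _; rewrite [leRHS]mulrDl; apply: lerD; rewrite !normrM.
  have -> : D * C ^+ 2 * d = (D * d) * (C * C) by ring.
  by apply: ler_pM => //; apply: ler_pM.
have -> : D * (2 * C ^+ 2) * d = D * ((C * d) * (C + C)) by ring.
apply: ler_pM; rewrite ?mulr_ge0 //; apply: ler_pM => //.
exact: le_trans (ler_normD _ _) (lerD cy cx).
Qed.

(** The form of [B] is bounded above on the sphere. This lets the gradient norm replace the square
    root of [sqr_wronskian] in the desingularization. *)
Lemma sqrt_wronskian_le : exists2 L, 0 < L & forall x, S x ->
  Num.sqrt (sqr_wronskian x) <= L * enorm (grad f x).
Proof.
have [C C0 CP] := form_bound.
exists (C ^+ 2 + 1) => [|x Sx]; first by have := exprn_ge0 2 C0; lra.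
have [cx _ _] := CP _ _ Sx Sx; have bx := sphere_B_gt0 Sx.
have -> : enorm (grad f x) = m.+1%:R / tensor_form B x ^+ 2 * Num.sqrt (sqr_wronskian x).
  rewrite grad_wronskian // /enorm mulmx_dot dotZl dotZr mulrA -expr2.
  rewrite sqrtrM ?sqr_ge0 // sqrtr_sqr ger0_norm //.
  by rewrite divr_ge0 ?exprn_ge0 // ltW.
rewrite mulrA ler_peMl ?sqrtr_ge0 // mulrA ler_pdivlMr ?exprn_gt0 // mul1r.
have : tensor_form B x ^+ 2 <= C ^+ 2.
  by rewrite ler_pXn2r ?nnegrE ?(ltW bx) // (le_trans (ler_norm _)).
have : (1 : R) <= m.+1%:R by rewrite ler1n.
have : 0 <= C ^+ 2 by rewrite exprn_ge0.
move=> c0 m1 bC; apply: le_trans bC _; apply: le_trans (_ : C ^+ 2 + 1 <= _).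
  by rewrite lerDl.
by rewrite ler_peMr //; lra.
Qed.

Lemma quotient_desingularization c : exists d (Psi : R -> R) M,
  [/\ 0 < d, forall t, 0 < t < d -> `|Psi t| <= M &
   forall x s, S x -> 0 < f x - c < d -> 0 < s < f x - c ->
     f x - c - s <= Num.sqrt (sqr_wronskian x) * (Psi (f x - c) - Psi s)].
Proof.
(* Clearing the positive denominator turns a level set of the quotient into a polynomial condition,
   hence a closed and definable one. *)
have levelE t x : S x /\ f x - c = t <->
    dot x x = 1 /\ tensor_form H x - (t + c) * tensor_form B x = 0.
  split=> [[Sx <-]|[/sphere_dot Sx E]]; have B0 := sphere_B_gt0 Sx; split => //.
  - exact/sphere_dot.
  - by rewrite subrK /tensor_quotient divfK ?subrr // gt_eqF.
  - move/eqP: E; rewrite subr_eq0 /tensor_quotient => /eqP->.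
    by rewrite mulfK ?addrK // gt_eqF.
have [L L0 LP] := quotient_slope.
apply: (@desingularization R n S (fun x => f x - c) sqr_wronskian (L + 1)).
- exact: sphere_compact.
- move=> i k; apply: (@definable_ext _ (fun rho => dot (block n k rho) (block n k rho) = 1 /\
    tensor_form H (block n k rho) - (rho i + c) * tensor_form B (block n k rho) = 0)).
    by move=> rho; rewrite levelE.
  apply: definable_and; apply: definable_eq; do ?exact: polyfun_const.
    exact: (polyfun_pm (pm_dot R n) k).
  apply: polyfunB; first exact: (polyfun_pm (pm_tensor_form H) k).
  apply: polyfunM; last exact: (polyfun_pm (pm_tensor_form B) k).
  by apply: polyfunD; [exact: polyfun_var|exact: polyfun_const].
- move=> t; rewrite (_ : [set x | _] =
    S `&` [set x | tensor_form H x - (t + c) * tensor_form B x = 0]).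
    apply: compact_closedI; first exact: sphere_compact.
    apply: closed_pm; apply: pm_sub; first exact: pm_tensor_form.
    by apply: pm_mul; [exact: pm_const|exact: pm_tensor_form].
  by apply/seteqP; split => x /=; rewrite levelE sphere_dot.
- exact: polyfun_pm pm_sqr_wronskian.
- exact: continuous_pm pm_sqr_wronskian.
- by move=> x; exact: dot_self_ge0.
- by lra.
- move=> x y Sx Sy; rewrite opprB addrA subrK; apply: le_trans (LP _ _ Sx Sy) _.
  by rewrite ler_wpM2r ?lerDl // addr_ge0 ?mulr_ge0 ?sqrtr_ge0 ?exprn_ge0.
Qed.

End Quotient.

(** * Convergence of the algorithm *)

Section FiniteLength.
Variables (R : realType) (n : nat) (x : nat -> 'rV[R]_n) (M : R).
Hypothesis length_le : forall p, \sum_(0 <= k < p) enorm (x k.+1 - x k) <= M.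

(* Each coordinate is the difference of two bounded nondecreasing sequences,
   the length of the path and its sum with the coordinate. *)
Lemma finite_length_cvg : cvgn x.
Proof.
pose s p := \sum_(0 <= k < p) enorm (x k.+1 - x k).
have s_cvg : cvgn s.
  apply: nondecreasing_is_cvgn; last by exists M => _ [p _ <-]; exact: length_le.
  apply/nondecreasing_seqP => p; rewrite /s big_nat_recr //= lerDl.
  exact: enorm_ge0.
have coord_cvg i : cvgn (fun k => x k 0 i).
  have step k : `|x k.+1 0 i - x k 0 i| <= s k.+1 - s k.
    rewrite /s big_nat_recr //= [leRHS]addrC addKr; apply: le_trans (norm_le_enorm _).
    by apply: le_trans (coord_le_norm _ i); rewrite !mxE.
  have u_cvg : cvgn (fun k => x k 0 i + s k).
    apply: nondecreasing_is_cvgn.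
      apply/nondecreasing_seqP => k; have := step k; rewrite ler_norml; lra.
    exists (x 0 0 i + 2 * M) => _ [p _ <-].
    have : x p 0 i <= x 0 0 i + s p.
      elim: p => [|p IH]; first by rewrite /s big_geq // addr0.
      have := step p; rewrite ler_norml; lra.
    have := length_le p; rewrite -/(s p); lra.
  rewrite (_ : (fun k => _) = (fun k => x k 0 i + s k) - s).
    exact: is_cvgB.
  by apply/funext => k; rewrite !fctE addrK.
apply/cvg_ex; exists (\row_i limn (fun k => x k 0 i)); apply/cvgrPdist_lt => e e0.
have : \forall k \near \oo, forall i, `|limn (fun k => x k 0 i) - x k 0 i| <= e / 2.
  apply: filter_forall => i; have e20 : 0 < e / 2 by rewrite divr_gt0.
  have /cvgrPdist_lt/(_ _ e20) := coord_cvg i.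
  by apply: filterS => k /ltW.
apply: filterS => k hk; apply: le_lt_trans (_ : e / 2 < e); last lra.
by apply: norm_le_coord => [|i]; [lra|rewrite !mxE].
Qed.

Lemma finite_length_series :
  (\sum_(0 <= k <oo) (enorm (x k.+1 - x k))%:E < +oo)%E.
Proof.
apply: le_lt_trans (ltry M); apply: lime_le.
  by apply: is_cvg_nneseries => k _ _; rewrite lee_fin enorm_ge0.
by apply: nearW => p; rewrite sumEFin lee_fin.
Qed.

End FiniteLength.

(** * The search curve, the step sizes and the iterates *)

Section Convergence.
Variables (R : realType) (n m : nat) (H B : tensor R m.+1 n).
Hypotheses (H_sym : symmetric_tensor H) (B_sym : symmetric_tensor B).
Hypothesis B_pd : posdef_tensor B.
Variables (eta beta amax : R).
Hypotheses (eta_range : 0 < eta <= 1 / 2) (beta_range : 0 < beta < 1).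
Hypothesis amax_ge1 : 1 <= amax.

Local Notation S := (@unit_sphere R n).
Local Notation f := (tensor_quotient H B).
Local Notation g := (grad f).

(** By [dot_grad], [y] and [g y] are orthogonal; the curve is the rational parametrization of a
    great circle, with [a * enorm (g y)] the tangent of the half-angle. *)
Lemma sqr_curve_step y a : S y -> enorm (acsa_curve f y a - y) ^+ 2 =
  4 * a ^+ 2 * enorm (g y) ^+ 2 / (1 + a ^+ 2 * enorm (g y) ^+ 2).
Proof.
move=> Sy; have gy := dot_grad H_sym B_sym B_pd Sy; have /sphere_dot y1 := Sy.
rewrite !enorm_sqr /acsa_curve enorm_sqr; have := dot_self_ge0 (g y).
set c := a ^+ 2 * dot (g y) (g y) => g0.
have c0 : 0 < 1 + c by rewrite ltr_pwDl // mulr_ge0 ?sqr_ge0.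
set r := (1 - c) / (1 + c); set q := 2 * a / (1 + c).
have -> : r *: y - q *: g y - y = (r - 1) *: y + (- q) *: g y.
  by rewrite scalerBl scale1r scaleNr addrAC.
rewrite !dotDl !dotDr !dotZl !dotZr (dotC y) gy y1 /q /r /c; field.
by rewrite gt_eqF.
Qed.

Lemma dot_grad_curve_step y a : S y -> dot (g y) (acsa_curve f y a - y) =
  - (2 * a * enorm (g y) ^+ 2 / (1 + a ^+ 2 * enorm (g y) ^+ 2)).
Proof.
move=> Sy; have gy := dot_grad H_sym B_sym B_pd Sy.
rewrite /acsa_curve enorm_sqr; set c := a ^+ 2 * _.
set r := (1 - c) / (1 + c); set q := 2 * a / (1 + c).
have -> : r *: y - q *: g y - y = (r - 1) *: y + (- q) *: g y.
  by rewrite scalerBl scale1r scaleNr addrAC.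
by rewrite dotDr !dotZr gy mulr0 add0r mulNr /q mulrAC.
Qed.

Lemma curve_on_sphere y a : S y -> S (acsa_curve f y a).
Proof.
move=> Sy; have gy := dot_grad H_sym B_sym B_pd Sy; have /sphere_dot y1 := Sy.
apply/sphere_dot; rewrite /acsa_curve enorm_sqr; have := dot_self_ge0 (g y).
set c := a ^+ 2 * dot (g y) (g y) => g0.
have c0 : 0 < 1 + c by rewrite ltr_pwDl // mulr_ge0 ?sqr_ge0.
set r := (1 - c) / (1 + c); set q := 2 * a / (1 + c).
rewrite -scaleNr !dotDl !dotDr !dotZl !dotZr (dotC y) gy y1 /q /r /c; field.
by rewrite gt_eqF.
Qed.

Lemma small_step_accepted : exists2 A, 0 < A &
  forall y a, S y -> 0 < a <= A -> acsa_decrease f eta y a.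
Proof.
have [L L0 LP] := quotient_descent H_sym B_sym B_pd.
have [G G0 GP] := grad_bound H_sym B_sym B_pd.
have /andP[_ eta2] := eta_range.
(* With [q] the first-order decrease, the first bound keeps the second-order term below [q / 2]. The
   second gives [a * h <= 1], hence [a * h ^+ 2 <= q], and [eta <= 1 / 2] then leaves room for the
   required decrease. *)
exists (Num.min (4 * (L + 1))^-1 (G + 1)^-1).
  by rewrite lt_min !invr_gt0 mulr_gt0 //; lra.
move=> y a Sy /andP[a0]; rewrite le_min => /andP[aL aG].
have {}aL : a * (4 * (L + 1)) <= 1.
  by rewrite -ler_pdivlMr ?mul1r // mulr_gt0 //; lra.
have {}aG : a * (G + 1) <= 1 by rewrite -ler_pdivlMr ?mul1r //; lra.
have Sz := curve_on_sphere a Sy; rewrite /acsa_decrease.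
apply: le_trans (LP _ _ Sy Sz) _; rewrite dot_grad_curve_step //.
have nz : `|acsa_curve f y a - y| ^+ 2 <= enorm (acsa_curve f y a - y) ^+ 2.
  by rewrite ler_pXn2r ?nnegrE ?enorm_ge0 // norm_le_enorm.
have := ler_wpM2l L0 nz; rewrite sqr_curve_step //.
have gG := GP _ Sy; have g0 := enorm_ge0 (g y); set h := enorm (g y) in gG g0 *.
have ah : a * h <= 1 by apply: le_trans aG; rewrite ler_wpM2l; lra.
have ah0 : 0 <= a * h by rewrite mulr_ge0 // ltW.
have c1 : a ^+ 2 * h ^+ 2 <= 1 by rewrite -exprMn expr_le1.
have c0 : 0 <= a ^+ 2 * h ^+ 2 by rewrite -exprMn exprn_ge0.
set c := a ^+ 2 * h ^+ 2 in c0 c1 *.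
set q := 2 * a * h ^+ 2 / (1 + c).
have -> : L * (4 * a ^+ 2 * h ^+ 2 / (1 + c)) = 2 * (L * a) * q.
  by rewrite /q; field; lra.
have q0 : 0 <= q.
  by rewrite divr_ge0 ?mulr_ge0 ?exprn_ge0 ?(ltW a0) //; lra.
have qh : a * h ^+ 2 <= q.
  rewrite /q ler_pdivlMr; last lra.
  have -> : 2 * a * h ^+ 2 = a * h ^+ 2 * 2 by ring.
  by rewrite ler_wpM2l ?mulr_ge0 ?exprn_ge0 ?(ltW a0) //; lra.
have La : L * a * q <= q / 4.
  rewrite mulrC ler_wpM2l //; lra.
have ea : eta * a * h ^+ 2 <= q / 2.
  have : 0 <= a * h ^+ 2 by rewrite mulr_ge0 ?exprn_ge0 ?(ltW a0).
  rewrite -mulrA => ah2; apply: le_trans (_ : 1 / 2 * (a * h ^+ 2) <= _).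
    by rewrite ler_wpM2r //; lra.
  lra.
by move=> nzL; lra.
Qed.

Variables (x : nat -> 'rV[R]_n) (alpha abar : nat -> R).
Hypothesis run : acsa_run f eta beta amax x alpha abar.

Lemma iterate_on_sphere k : S (x k).
Proof.
elim: k => [|k IH]; first exact: acsa_x0 run.
by rewrite (acsa_xS run); exact: curve_on_sphere.
Qed.

Lemma iterate_grad_gt0 k : 0 < enorm (g (x k)).
Proof.
rewrite lt_neqAle enorm_ge0 andbT eq_sym; apply/eqP => g0.
apply: (acsa_grad_neq0 run (k := k)); apply/eqP; rewrite -normr_le0 -g0.
exact: norm_le_enorm.
Qed.

Lemma step_size_bounds : exists2 a, 0 < a & forall k, a <= alpha k <= amax.
Proof.
have [A A0 AP] := small_step_accepted.
have [L L0 LP] := grad_lipschitz H_sym B_sym B_pd.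
have /andP[b0 b1] := beta_range.
(* The initial step is bounded below because the gradient is Lipschitz on the sphere. *)
have bar k : Num.min 1 (L + 1)^-1 <= abar k <= amax.
  case: k => [|k]; first by rewrite (acsa_abar0 run) ge_min lexx amax_ge1.
  rewrite (acsa_abarS run) /acsa_initial_step; case: eqP => [_|gN].
    by rewrite ge_min amax_ge1 lexx.
  rewrite le_min ge_min amax_ge1 /= !ge_min lexx andbT; apply/orP; right.
  have Lg := LP _ _ (iterate_on_sphere k) (iterate_on_sphere k.+1).
  have gg : 0 < enorm (g (x k.+1) - g (x k)).
    rewrite lt_neqAle enorm_ge0 andbT eq_sym; apply/eqP => g0.
    apply: gN; apply/eqP; rewrite -subr_eq0 -normr_le0 -g0.
    exact: norm_le_enorm.
  rewrite ler_pdivlMr // mulrC ler_pdivrMr; last lra.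
  apply: le_trans Lg _; rewrite mulrC.
  by apply: ler_pM => //; [exact: norm_le_enorm|lra].
have m0 : 0 < Num.min 1 (L + 1)^-1 by rewrite lt_min ltr01 invr_gt0; lra.
exists (Num.min (Num.min 1 (L + 1)^-1) (beta * A)) => [|k].
  by rewrite lt_min m0 mulr_gt0.
have [l [-> _ lmin]] := acsa_line_search run k.
have /andP[bar1 bar2] := bar k; have bar0 : 0 < abar k by apply: lt_le_trans bar1.
apply/andP; split; last first.
  apply: le_trans bar2; rewrite ler_piMl ?(ltW bar0) // exprn_ile1 ?ltW //.
case: l lmin => [|l] lmin; first by rewrite expr0 mul1r ge_min bar1.
rewrite ge_min exprS -mulrA ler_pM2l //; apply/orP; right.
(* The last rejected trial step is at least [A], and the accepted one is [beta] times it. *)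
rewrite leNgt; apply/negP => lA; apply: (lmin l) => //; apply: AP.
  exact: iterate_on_sphere.
by rewrite mulr_gt0 ?exprn_gt0 //= ltW.
Qed.

(** With [c = (alpha k * h) ^+ 2], the squared step is [4 * c / (1 + c)], where [c] is bounded. The
    first bound serves the finite length, the second the criticality of the limit. *)
Lemma step_length : exists2 K, 0 < K & forall k,
  [/\ enorm (x k.+1 - x k) <= 2 * alpha k * enorm (g (x k)) &
      enorm (g (x k)) <= K * enorm (x k.+1 - x k)].
Proof.
have [a a0 aP] := step_size_bounds.
have [G G0 GP] := grad_bound H_sym B_sym B_pd.
have AG : 0 <= (amax * G) ^+ 2 by exact: sqr_ge0.
exists ((1 + (amax * G) ^+ 2) / (2 * a)) => [|k].
  by rewrite divr_gt0 ?mulr_gt0 //; lra.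
have /andP[ak1 ak2] := aP k; have ak0 : 0 < alpha k by apply: lt_le_trans ak1.
have Sk := iterate_on_sphere k; have gG := GP _ Sk.
have := sqr_curve_step (alpha k) Sk; rewrite -(acsa_xS run).
have := iterate_grad_gt0 k; have := enorm_ge0 (x k.+1 - x k).
set h := enorm (g (x k)) in gG *; set d := enorm (x k.+1 - x k) => d0 h0.
have ah0 : 0 <= alpha k * h by rewrite mulr_ge0 // ltW.
have ah : (alpha k * h) ^+ 2 <= (amax * G) ^+ 2.
  by rewrite ler_pXn2r ?nnegrE // ?mulr_ge0 // ?ler_pM // ?(ltW h0) ?(ltW ak0) //; lra.
set c := (alpha k * h) ^+ 2 in ah *.
have cE : alpha k ^+ 2 * h ^+ 2 = c by rewrite /c exprMn.
have c0 : 0 <= c by exact: sqr_ge0.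
have c1 : 0 < 1 + c by lra.
move=> dE; have {}dE : d ^+ 2 * (1 + c) = 4 * c by rewrite dE cE divfK ?gt_eqF // -mulrA cE.
have d2 : 0 <= d ^+ 2 * c by rewrite mulr_ge0 ?exprn_ge0.
split.
  rewrite -mulrA -(ler_pXn2r (n := 2)) ?nnegrE ?mulr_ge0 ?(ltW ak0) ?(ltW h0) //.
  by rewrite exprMn -/c; lra.
rewrite mulrAC ler_pdivlMr ?mulr_gt0 //.
apply: le_trans (_ : (1 + c) * d <= _); last by rewrite ler_wpM2r //; lra.
apply: le_trans (_ : 2 * (alpha k * h) <= _).
  rewrite mulrC -mulrA ler_wpM2l // ler_wpM2r //; lra.
rewrite -(ler_pXn2r (n := 2)) ?nnegrE ?mulr_ge0 ?(ltW ak0) ?(ltW h0) ?(ltW c1) //.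
rewrite !exprMn -/c (_ : (1 + c) ^+ 2 * d ^+ 2 = (1 + c) * (d ^+ 2 * (1 + c))); last by ring.
by rewrite dE; have := mulr_ge0 c0 c0; lra.
Qed.

Lemma iterate_decrease k :
  f (x k.+1) <= f (x k) - eta * alpha k * enorm (g (x k)) ^+ 2.
Proof.
by have [l [_ + _]] := acsa_line_search run k; rewrite (acsa_xS run).
Qed.

Lemma iterate_decreasing k : f (x k.+1) < f (x k).
Proof.
have [a a0 /(_ k)/andP[ak _]] := step_size_bounds; have /andP[eta0 _] := eta_range.
apply: le_lt_trans (iterate_decrease k) _; rewrite ltrBlDr ltrDl.
by rewrite !mulr_gt0 ?exprn_gt0 ?iterate_grad_gt0 // (lt_le_trans a0).
Qed.

Lemma values_converge : exists c, (forall k, c < f (x k)) /\ f (x k) @[k --> \oo] --> c.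
Proof.
have [L L0 LP] := quotient_slope H_sym B_sym B_pd.
have dec : {homo (fun k => f (x k)) : p q / (p <= q)%N >-> q <= p}.
  by apply/nonincreasing_seqP => k; exact: ltW (iterate_decreasing k).
have cv : cvgn (fun k => f (x k)).
  apply: nonincreasing_is_cvgn => //.
  (* A lower bound for the values, from the slope bound at [x 0]: points of the sphere are at sup
     distance at most [2]. *)
  exists (f (x 0) - L * (Num.sqrt (sqr_wronskian H B (x 0)) * 2 + 2 ^+ 2)) => _ [k _ <-].
  have S0 := iterate_on_sphere 0; have Sk := iterate_on_sphere k.
  have := LP _ _ S0 Sk; rewrite ler_norml => /andP[+ _].
  have d2 : `|x k - x 0| <= 2.
    apply: le_trans (ler_normB _ _) _.
    have := sphere_norm S0; have := sphere_norm Sk; lra.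
  have : L * (Num.sqrt (sqr_wronskian H B (x 0)) * `|x k - x 0| + `|x k - x 0| ^+ 2) <=
     L * (Num.sqrt (sqr_wronskian H B (x 0)) * 2 + 2 ^+ 2).
    by rewrite ler_wpM2l // lerD ?ler_wpM2l ?sqrtr_ge0 // ler_pXn2r ?nnegrE.
  lra.
exists (limn (fun k => f (x k))); split => // k.
apply: le_lt_trans (iterate_decreasing k).
exact: (nonincreasing_cvgn_ge dec cv).
Qed.

Lemma iterates_finite_length : exists M, forall p,
  \sum_(0 <= k < p) enorm (x k.+1 - x k) <= M.
Proof.
have [c [cf cvc]] := values_converge.
have [d [Psi [M [d0 PsiM PsiP]]]] := quotient_desingularization H_sym B_sym B_pd c.
have [K K0 KP] := sqrt_wronskian_le H_sym B_sym B_pd.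
have [K' K'0 K'P] := step_length.
have /andP[eta0 _] := eta_range.
have : \forall k \near \oo, f (x k) < c + d.
  by apply: (cvgr_lt _ cvc); rewrite ltrDl.
move=> [N _ NP].
have {}NP k : (N <= k)%N -> 0 < f (x k) - c < d.
  by move=> /NP /= fk; rewrite subr_gt0 cf /= ltrBlDl.
pose C := 2 * K / eta; have C0 : 0 < C by rewrite divr_gt0 ?mulr_gt0.
pose P k := Psi (f (x k) - c).
(* With [h] the gradient norm, [eta * alpha k * h ^+ 2] is at most the decrease of [f], hence at
   most [K * h * (P k - P k.+1)]; dividing by [h] bounds the step, which is at most
   [2 * alpha k * h]. *)
have step k : (N <= k)%N -> enorm (x k.+1 - x k) <= C * (P k - P k.+1).
  move=> Nk; have t1 := NP _ Nk; have /andP[t2 _] := NP _ (leqW Nk).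
  have Sk := iterate_on_sphere k; have g0 := iterate_grad_gt0 k.
  have [dx _] := K'P k.
  have tt := iterate_decreasing k.
  have := PsiP _ (f (x k.+1) - c) Sk t1; rewrite t2 ltrD2r tt => /(_ isT).
  rewrite opprB addrA subrK -/(P k) -/(P k.+1) => psi.
  have P0 : 0 <= P k - P k.+1.
    rewrite leNgt; apply/negP => Pneg.
    have := mulr_ge0 (sqrtr_ge0 (sqr_wronskian H B (x k))) (ltW (_ : 0 < - (P k - P k.+1))).
    by rewrite oppr_gt0 => /(_ Pneg); rewrite mulrN; lra.
  have := ler_wpM2r P0 (KP _ Sk).
  have := iterate_decrease k; move: g0 dx psi.
  set h := enorm (g (x k)); set e := enorm _; set s := Num.sqrt _ * _.
  move=> g0 dx psi dec sK.
  rewrite -(ler_pM2l g0) /C -(ler_pM2l eta0).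
  have -> : eta * (h * (2 * K / eta * (P k - P k.+1))) = 2 * (K * h * (P k - P k.+1)).
    by field; rewrite gt_eqF.
  apply: le_trans (_ : 2 * (eta * alpha k * h ^+ 2) <= _); last lra.
  have -> : 2 * (eta * alpha k * h ^+ 2) = eta * (h * (2 * alpha k * h)) by ring.
  by rewrite !ler_pM2l.
have M0 : 0 <= M by have := PsiM _ (NP _ (leqnn N)); exact: le_trans.
(* The first [N] steps are kept as they are; the remaining ones telescope, and [Psi] varies by at
   most [2 * M]. *)
exists (\sum_(0 <= k < N) enorm (x k.+1 - x k) + C * (2 * M)) => p.
have E0 k : 0 <= enorm (x k.+1 - x k) by exact: enorm_ge0.
have [pN|Np] := leqP p N.
  rewrite [X in _ <= X + _](big_cat_nat (leq0n p) pN) //= -addrA lerDl; apply: addr_ge0.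
    by apply: sumr_ge0.
  by apply: mulr_ge0; [exact: ltW|exact: mulr_ge0].
rewrite [leLHS](big_cat_nat (leq0n N) (ltnW Np)) //= lerD2l.
apply: le_trans (_ : C * (P N - P p) <= _).
  elim: p Np => // p IH; rewrite ltnS leq_eqVlt => /orP[/eqP<-|Np].
    by rewrite big_nat1 step.
  rewrite big_nat_recr ?(ltnW Np) //=; have := IH Np; have := step _ (ltnW Np); lra.
rewrite ler_pM2l //.
have := PsiM _ (NP _ (leqnn N)); have := PsiM _ (NP _ (ltnW Np)).
by rewrite -/(P N) -/(P p) !ler_norml; lra.
Qed.

(** The gradient at an iterate is bounded by the length of the next step, which tends to [0] as the
    iterates converge; the Lipschitz bound carries this over to the limit. *)
Lemma limit_critical xs : x @ \oo --> xs -> S xs /\ g xs = 0.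
Proof.
move=> xcv; have [L L0 LP] := grad_lipschitz H_sym B_sym B_pd.
have [K K0 KP] := step_length.
have Sxs : S xs.
  apply: (closed_cvg (F := \oo) (u_ := x)) xcv.
    exact: compact_closed (@sphere_compact R n).
  by apply: nearW; exact: iterate_on_sphere.
split => //; apply/eqP; rewrite -normr_le0; apply/ler_addgt0Pl => e e0; rewrite addr0.
pose C := L + 2 * (K * n%:R) + 1.
have C1 : 1 <= C by rewrite /C lerDr addr_ge0 // !mulr_ge0 // ltW.
have C0 : 0 < C by lra.
have ec : 0 < e / C by rewrite divr_gt0.
have [N _ NP] : \forall k \near \oo, `|xs - x k| < e / C.
  by move/cvgrPdist_lt: xcv; apply.
have h1 : `|xs - x N| < e / C by apply: NP => /=.
have h2 : `|xs - x N.+1| < e / C by apply: NP => /=.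
have Lg := LP _ _ (iterate_on_sphere N) Sxs.
have [_ Kg] := KP N.
have dx : enorm (x N.+1 - x N) <= n%:R * (2 * (e / C)).
  apply: le_trans (enorm_le_norm _) _; rewrite ler_wpM2l //.
  rewrite (_ : x N.+1 - x N = (x N.+1 - xs) + (xs - x N)); last by rewrite addrA subrK.
  apply: le_trans (ler_normD _ _) _; rewrite [`|x N.+1 - _|]distrC; lra.
rewrite -[g xs](subrK (g (x N))); apply: le_trans (ler_normD _ _) _.
apply: le_trans (lerD (norm_le_enorm _) (norm_le_enorm _)) _.
apply: le_trans (_ : L * (e / C) + K * (n%:R * (2 * (e / C))) <= _).
  apply: lerD; first by apply: le_trans Lg _; rewrite ler_wpM2l // ltW.
  by apply: le_trans Kg _; rewrite ler_wpM2l // ltW.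
have -> : L * (e / C) + K * (n%:R * (2 * (e / C))) = (L + 2 * (K * n%:R)) * (e / C) by ring.
rewrite mulrCA ler_piMr ?(ltW e0) // ler_pdivrMr // mul1r /C lerDl //.
Qed.

End Convergence.

Theorem theorem6 (R : realType) (m n : nat)
    (m_gt0 : (0 < m)%N) (m_even : ~~ odd m) (n_gt0 : (0 < n)%N)
    (v : 'rV[R]_(m * n.-1).+1)
    (B : tensor R m n) (B_sym : symmetric_tensor B) (B_pd : posdef_tensor B)
    (eta beta amax : R)
    (eta_range : 0 < eta <= 1 / 2) (beta_range : 0 < beta < 1)
    (amax_ge1 : 1 <= amax)
    (x : nat -> 'rV[R]_n) (alpha abar : nat -> R) :
  let f := tensor_quotient (hankel_tensor v) B in
  acsa_run f eta beta amax x alpha abar ->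
  (\sum_(0 <= k <oo) (enorm (x k.+1 - x k))%:E < +oo)%E /\
  (exists! xs : 'rV[R]_n,
     [/\ unit_sphere xs, grad f xs = 0 & x @ \oo --> xs]).
Proof.
case: m m_gt0 m_even v B B_sym B_pd => // m _ _ v B B_sym B_pd f run.
have H_sym := hankel_tensor_sym v.
have [M lenM] := iterates_finite_length H_sym B_sym B_pd eta_range beta_range amax_ge1 run.
split; first exact: finite_length_series lenM.
have /cvg_ex[xs xcv] := finite_length_cvg lenM.
have [Sxs gxs] := limit_critical H_sym B_sym B_pd eta_range beta_range amax_ge1 run xcv.
exists xs; split => // y [_ _ ycv].
by apply: (cvg_unique _ xcv ycv); exact: norm_hausdorff.
Qed.
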